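(* Let $U\subset\mathbb{C}$ be a domain containing $0$, let $V\subset\mathbb{C}$ be a domain, and let $\phi$ be a holomorphic function on $U$ with $\phi(0)=0$, $\phi'\neq 0$ on $U$, and $\phi'(0)=1$. Let $a,b,c,d$ be smooth functions on $V$, with $a,d$ real-valued, $a>0$, and $b,c$ complex-valued, and suppose that $$u(z,w)=a(w)|\phi(z)|^2+b(w)\phi^2(z)+\overline{b(w)\phi^2(z)}+c(w)\phi(z)+\overline{c(w)\phi(z)}+d(w)$$ is a smooth solution to $\det(\partial\bar\partial u)=1$ on $U\times V$. Then either $\phi(z)=z$ identically (so that $\phi$ extends to all of $\mathbb{C}$ as $z$), or there exists a nonzero complex constant $\alpha$ such that $$\phi(z)=\frac{1-\sqrt{1-2\alpha z}}{\alpha}$$ for all $z$ in the connected component of $U\cap D_{\frac{1}{2|\alpha|}}$ containing $0$ (so that $\phi$ is given by this formula on $D_{\frac{1}{2|\alpha|}}$), where the complex square root takes the principal branch.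
   Context: Coordinates on $\mathbb{C}^2$ are $(z,w)$; $D_r=\{z\in\mathbb{C}:|z|<r\}$. For a real-valued function $u$ on an open subset of $\mathbb{C}^2$, $\partial\bar\partial u$ denotes its complex Hessian, the $2\times 2$ matrix $\begin{bmatrix} u_{\bar z z} & u_{z\bar w}\\ u_{\bar z w} & u_{\bar w w}\end{bmatrix}$. *)

(* Defs.v *)
From HB Require Import structures.
From mathcomp Require Import all_boot all_order all_algebra complex.
From mathcomp Require Import all_classical all_reals all_analysis.
Import Order.TTheory GRing.Theory Num.Theory.
Import numFieldNormedType.Exports.

Set Implicit Arguments.
Unset Strict Implicit.
Unset Printing Implicit Defensive.

Local Open Scope classical_set_scope.
Local Open Scope ring_scope.
Local Open Scope complex_scope.

(* The library puts the usual topology of the complex plane R[i] on its alias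
   R[i]^o, regarded as a normed space over R[i]. *)

Definition domain (R : realType) (U : set R[i]^o) : Prop :=
  [/\ U !=set0, open U & connected U].

Definition disc (R : realType) (r : R) : set R[i]^o :=
  [set z | complex.Re `|z| < r].

(* The increment in ['D_1] ranges over R[i], so these are complex derivatives. *)
Definition cderiv (R : realType) (f : R[i] -> R[i]) (z : R[i]) : R[i] :=
  'D_1 (f : R[i]^o -> R[i]^o) z.

Definition holomorphic_on (R : realType) (U : set R[i]^o)
    (f : R[i] -> R[i]) : Prop :=
  forall z : R[i], U z -> derivable (f : R[i]^o -> R[i]^o) z 1.

(* [psi] is holomorphic on [B] and coincides with [f] on the subset [A]. *)
Definition holomorphic_extension (R : realType) (A B : set R[i]^o)
    (f psi : R[i] -> R[i]) : Prop :=
  [/\ A `<=` B, holomorphic_on B psi & forall z : R[i], A z -> f z = psi z].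

(* C^m is identified with R^(m+m): the real parts of the coordinates come
   first, then the imaginary parts. *)
Definition of_real (R : realType) (m : nat) (p : 'rV[R]_(m + m)) :
    'rV[R[i]]_m :=
  \row_j (p 0 (lshift m j) +i* p 0 (rshift m j)).

Definition to_real (R : realType) (m : nat) (x : 'rV[R[i]]_m) :
    'rV[R]_(m + m) :=
  row_mx (\row_j complex.Re (x 0 j)) (\row_j complex.Im (x 0 j)).

(* For [A] open: all iterated partial derivatives of [f] of order at most [k]
   exist and are continuous on [A]. *)
Fixpoint Ck_on (R : realType) (n : nat) (A : set 'rV[R]_n) (k : nat)
    (f : 'rV[R]_n -> R) : Prop :=
  (forall p, A p -> {for p, continuous f}) /\
  match k with
  | 0%N => True
  | k'.+1 => forall i : 'I_n,
      (forall p, A p -> derivable f p (delta_mx 0 i)) /\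
      Ck_on A k' (fun p => 'D_(delta_mx 0 i) f p)
  end.

Definition smooth_on (R : realType) (m : nat) (A : set 'rV[R[i]]_m)
    (f : 'rV[R[i]]_m -> R) : Prop :=
  forall k : nat,
    Ck_on [set p : 'rV[R]_(m + m) | A (of_real p)] k (fun p => f (of_real p)).

Definition smooth_on1 (R : realType) (V : set R[i]^o) (f : R[i] -> R) : Prop :=
  @smooth_on R 1 [set x | V (x 0 0)] (fun x => f (x 0 0)).

Definition csmooth_on1 (R : realType) (V : set R[i]^o)
    (f : R[i] -> R[i]) : Prop :=
  smooth_on1 V (fun w => complex.Re (f w)) /\
  smooth_on1 V (fun w => complex.Im (f w)).

Definition smooth_on2 (R : realType) (U V : set R[i]^o)
    (f : R[i] -> R[i] -> R) : Prop :=
  @smooth_on R 2 [set x | U (x 0 0) /\ V (x 0 1)] (fun x => f (x 0 0) (x 0 1)).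

Definition real_partial (R : realType) (m : nat) (i : 'I_(m + m))
    (F : 'rV[R[i]]_m -> R[i]) (x : 'rV[R[i]]_m) : R[i] :=
  'D_(delta_mx 0 i) (fun p => complex.Re (F (of_real p))) (to_real x) +i*
  'D_(delta_mx 0 i) (fun p => complex.Im (F (of_real p))) (to_real x).

(* The Wirtinger operators d/dz_j and d/d(conj z_j). *)
Definition wirtinger (R : realType) (m : nat) (j : 'I_m)
    (F : 'rV[R[i]]_m -> R[i]) (x : 'rV[R[i]]_m) : R[i] :=
  2^-1 * (real_partial (lshift m j) F x - (0 +i* 1) * real_partial (rshift m j) F x).

Definition wirtinger_bar (R : realType) (m : nat) (j : 'I_m)
    (F : 'rV[R[i]]_m -> R[i]) (x : 'rV[R[i]]_m) : R[i] :=
  2^-1 * (real_partial (lshift m j) F x + (0 +i* 1) * real_partial (rshift m j) F x).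

(* Rows carry the holomorphic index, columns the antiholomorphic one. *)
Definition complex_hessian (R : realType) (m : nat) (f : 'rV[R[i]]_m -> R)
    (x : 'rV[R[i]]_m) : 'M[R[i]]_m :=
  \matrix_(j, k) wirtinger j (wirtinger_bar k (fun y => (f y)%:C)) x.

Definition complex_hessian2 (R : realType) (f : R[i] -> R[i] -> R)
    (z w : R[i]) : 'M[R[i]]_2 :=
  complex_hessian (fun x : 'rV[R[i]]_2 => f (x 0 0) (x 0 1))
    (\row_j if j == 0 then z else w).

(* [sqrtc] is the principal square root: its values have nonnegative real part,
   and negative reals are sent to the positive imaginary axis. *)
Definition sqrt_branch (R : realType) (alpha z : R[i]) : R[i] :=
  (1 - sqrtc (1 - 2 * alpha * z)) / alpha.

(* Main.v *)
Require Import Defs.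
From mathcomp Require Import all_boot all_order all_algebra complex.
From mathcomp Require Import all_classical all_reals all_analysis.
From mathcomp Require Import ring lra.
Import Order.TTheory GRing.Theory Num.Theory.
Import numFieldNormedType.Exports.

(** Fix w in V. By the form of u, the equation det = 1 at (z, w) reads
      |phi'|^2 (A |phi|^2 + B phi^2 + B' conj phi^2 + C phi + C' conj phi + 1) = 1
    with constants A, B, B', C, C' that depend on w ([monge_ampere_slice]). So
    f = 1 / phi' is holomorphic and its squared modulus is a quadratic polynomial
    in phi and conj phi. Differentiating this identity with respect to z and
    conj z forces B = B' = 0, h = f' / phi' constant, and f = e (1 + C phi) with
    |e| = 1 ([linear_coefficients]). Therefore phi' (1 + C phi) is locally
    constant; at 0 it equals 1, and integration gives phi + C phi^2 / 2 = z on U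
    ([quadratic_identity]). If C = 0 then phi = z. Otherwise alpha = - C and phi is
    the root of a quadratic equation; on the disc of radius 1 / (2 |alpha|) the
    quantity 1 - 2 alpha z has positive real part, and connectedness selects the
    principal branch ([sqrt_branch_extension]).

    Holomorphy of phi only means that it has a complex derivative at each point,
    and the argument differentiates phi several times. The regularity needed is
    extracted from the smoothness of u instead of Cauchy's theory. The derivative
    of u with respect to conj z is conj phi' * G, where G is a real-affine
    expression in phi and conj phi ([dbar_factor]). Where G does not vanish, phi'
    has continuous partial derivatives, and the symmetry of second derivatives
    gives the Cauchy-Riemann equation for phi' ([holo_derivative_holo],
    [phi'_holo]); the differentiations above are carried out there. Where G
    vanishes, u - u z is a quadratic form in phi - phi z, from which one still
    reads that a quarter of the Laplacian of u is a |phi'|^2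
    ([critical_laplacian]).

    It remains to see that phi' (1 + C phi) is constant near a zero of G. The
    Laplacian of u is positive there, so u is strictly convex in one of the two
    coordinate directions, and each nearby line in this direction meets the
    zeros of G at most once. The primitive phi + C phi^2 / 2 is affine on both sides
    of that point and differentiable at it, hence affine on the line; its
    complex derivative then does not vary across the lines either
    ([constant_near_critical]). *)

Set Implicit Arguments.
Unset Strict Implicit.
Unset Printing Implicit Defensive.

Local Open Scope classical_set_scope.
Local Open Scope ring_scope.
Local Open Scope complex_scope.
Import ComplexField.Normc.

(** * Calculus on the real line *)

(** Differentiability with the division cleared, so that the increment 0 needs
    no separate treatment. The field of scalars is R in some uses and R[i] in
    others. *)
Lemma is_derive_limit (K : numFieldType) (f : K^o -> K^o) (x l : K) :
  is_derive (x : K^o) (1 : K^o) f l <->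
  forall e : K, 0 < e -> exists2 r, 0 < r &
    forall t : K, `|t| < r -> `|f (x + t) - f x - l * t| <= e * `|t|.
Proof.
split=> [[fd fl] e e0|H].
- have := fd; rewrite /derivable -/(derive _ _ _).
  move/cvg_ex => [l' fl']; have ll' : l' = l by rewrite -fl; apply/esym/cvg_lim.
  move: fl'; rewrite {}ll' => /cvgrPdist_le /(_ _ e0).
  rewrite near_withinE => /nbhs_ballP [r r0 Hr]; exists r => // t tr.
  have [->|t0] := eqVneq t 0; first by rewrite addr0 subrr mulr0 subrr normr0 mulr0.
  have := Hr t; rewrite -ball_normE /= sub0r normrN => /(_ tr t0).
  rewrite -(ler_pM2r (x := `|t|)) ?normr_gt0// -normrM; apply: le_trans.
  by rewrite distrC le_eqVlt; apply/orP; left; apply/eqP; congr `|_|;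
     rewrite [t *: 1]mulr1 [_ *: _]mulrC (addrC x) mulrBl divfK.
- have H' : (fun h : K => h^-1 *: ((f \o shift x) (h *: (1:K^o)) - f x)) @ 0^' --> l.
    apply/cvgrPdist_le => e e0; rewrite near_withinE.
    have [r r0 Hr] := H e e0; apply/nbhs_ballP; exists r => // t.
    rewrite -ball_normE /= sub0r normrN => tr t0.
    rewrite -(ler_pM2r (x := `|t|)) ?normr_gt0// -normrM; apply: le_trans (Hr t tr).
    by rewrite distrC le_eqVlt; apply/orP; left; apply/eqP; congr `|_|;
       rewrite [t *: 1]mulr1 [_ *: _]mulrC (addrC x) mulrBl divfK.
  by apply: DeriveDef; [apply/cvg_ex; exists l|exact: cvg_lim].
Qed.


Section RealLine.
Variable R : realType.

Lemma is_derive_continuous (f : R -> R) (x l : R) :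
  is_derive x 1 f l -> {for x, continuous f}.
Proof. by move=> [/derivable1_diffP/differentiable_continuous]. Qed.

Lemma mean_value (f df : R -> R) (a b : R) : a < b ->
  (forall x, a <= x <= b -> is_derive x 1 f (df x)) ->
  exists2 c, a < c < b & f b - f a = df c * (b - a).
Proof.
move=> ab fd.
have [|c|c] := @MVT R f df a b ab.
- by move=> x; rewrite in_itv /= => /andP[ax xb]; apply: fd; rewrite !ltW.
- apply: continuous_in_subspaceT => x /[!inE] /=.
  by rewrite in_itv /= => xab; exact: (is_derive_continuous (fd x xab)).
- by rewrite in_itv /= => cab fE; exists c.
Qed.

(** No order between the endpoints is assumed; the price is that the
    intermediate point is only located by its distance to the first one. *)
Lemma mean_value_from (f df : R -> R) (a b : R) :
  (forall x, `|x - a| <= `|b - a| -> is_derive x 1 f (df x)) ->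
  exists2 c, `|c - a| <= `|b - a| & f b - f a = df c * (b - a).
Proof.
move=> fd; have [ab|ba|<-] := ltgtP a b.
- have [x /andP[ax xb]|c /andP[ac cb] fE] := @mean_value f df a b ab.
    by apply: fd; rewrite !ger0_norm; lra.
  by exists c => //; rewrite !ger0_norm; lra.
- have [x /andP[bx xa]|c /andP[bc ca] fE] := @mean_value f df b a ba.
    by apply: fd; rewrite !ler0_norm; lra.
  exists c; first by rewrite !ler0_norm; lra.
  by rewrite -opprB fE; ring.
- by exists a => //; rewrite !subrr mulr0.
Qed.

Lemma zero_derivative_constant (f : R -> R) (a b : R) :
  (forall x, `|x - a| <= `|b - a| -> is_derive x 1 f 0) -> f b = f a.
Proof.
move=> fd; have [c _] := @mean_value_from f (fun=> 0) a b fd.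
by rewrite mul0r => /eqP; rewrite subr_eq0 => /eqP.
Qed.

End RealLine.

(** * Symmetry of second derivatives *)
Section Schwarz.
Variable R : realType.

(** Two applications of the mean value theorem turn the second difference over
    a square into a value of the mixed derivative. Swapping the variables gives
    the other mixed derivative for the same difference, hence Schwarz's
    theorem below. *)
Lemma mixed_difference (g gx gxy : R -> R -> R) (r h : R) :
  (forall s t : R, `|s| < r -> `|t| < r -> is_derive s 1 (g^~ t) (gx s t)) ->
  (forall s t : R, `|s| < r -> `|t| < r -> is_derive t 1 (gx s) (gxy s t)) ->
  0 < h -> h < r ->
  exists s t, [/\ `|s| <= h, `|t| <= h &
    g h h - g h 0 - (g 0 h - g 0 0) = gxy s t * h * h].
Proof.
move=> gxP gxyP h0 hr; have r0 : 0 < r by exact: lt_trans hr.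
have hh : `|h| = h by rewrite gtr0_norm.
have [s|s] := @mean_value_from R (fun s => g s h - g s 0)
    (fun s => gx s h - gx s 0) 0 h.
  rewrite !subr0 hh => sh; have sr := le_lt_trans sh hr.
  by apply: is_deriveB; apply: gxP; rewrite ?hh ?normr0.
rewrite !subr0 hh => sh ->; have sr := le_lt_trans sh hr.
have [t|t] := @mean_value_from R (gx s) (gxy s) 0 h.
  by rewrite !subr0 hh => th; apply: gxyP => //; exact: le_lt_trans hr.
by rewrite !subr0 hh => th ->; exists s, t.
Qed.

Lemma schwarz (g gx gy gxy gyx : R -> R -> R) (r : R) : 0 < r ->
  (forall s t : R, `|s| < r -> `|t| < r -> is_derive s 1 (g^~ t) (gx s t)) ->
  (forall s t : R, `|s| < r -> `|t| < r -> is_derive t 1 (g s) (gy s t)) ->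
  (forall s t : R, `|s| < r -> `|t| < r -> is_derive t 1 (gx s) (gxy s t)) ->
  (forall s t : R, `|s| < r -> `|t| < r -> is_derive s 1 (gy^~ t) (gyx s t)) ->
  (forall e : R, 0 < e -> exists2 d : R, 0 < d & forall s t, `|s| < d -> `|t| < d ->
     `|gxy s t - gxy 0 0| < e) ->
  (forall e : R, 0 < e -> exists2 d : R, 0 < d & forall s t, `|s| < d -> `|t| < d ->
     `|gyx s t - gyx 0 0| < e) ->
  gxy 0 0 = gyx 0 0.
Proof.
move=> r0 gxP gyP gxyP gyxP gxyc gyxc.
apply/eqP; rewrite -subr_eq0 -normr_eq0; apply/negPn/negP => ne0.
have e0 : 0 < `|gxy 0 0 - gyx 0 0| / 2 by rewrite divr_gt0// lt_neqAle eq_sym ne0/=.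
have [d1 d10 H1] := gxyc _ e0; have [d2 d20 H2] := gyxc _ e0.
pose h := Num.min r (Num.min d1 d2) / 2.
have m0 : 0 < Num.min r (Num.min d1 d2) by rewrite !lt_min r0 d10 d20.
have h0 : 0 < h by rewrite divr_gt0.
have : h < Num.min r (Num.min d1 d2) by rewrite /h; lra.
rewrite !lt_min => /and3P[hr hd1 hd2].
have [s [t [sh th E1]]] := mixed_difference gxP gxyP h0 hr.
have [t' [s' [th' sh' E2]]] :=
  @mixed_difference (fun t s => g s t) (fun t s => gy s t) (fun t s => gyx s t) r h
    (fun t s tr sr => gyP s t sr tr) (fun t s tr sr => gyxP s t sr tr) h0 hr.
have E : gxy s t = gyx s' t'.
  have hh0 : h * h != 0 by rewrite mulf_neq0 ?gt_eqF.
  apply: (mulIf hh0); move: E1 E2 => /=; rewrite -!(mulrA _ h h) => <- <-; ring.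
have := H1 s t (le_lt_trans sh hd1) (le_lt_trans th hd1).
have := H2 s' t' (le_lt_trans sh' hd2) (le_lt_trans th' hd2).
rewrite -E => A B.
have : `|gxy 0 0 - gyx 0 0| <= `|gxy s t - gxy 0 0| + `|gxy s t - gyx 0 0|.
  rewrite (_ : gxy 0 0 - gyx 0 0 = (gxy s t - gyx 0 0) - (gxy s t - gxy 0 0)); last by ring.
  by rewrite (le_trans (ler_normB _ _))// addrC.
by lra.
Qed.

End Schwarz.

(** * Directional derivatives of complex-valued functions *)
Section Complex.
Variable R : realType.
Implicit Types (F G : R[i] -> R[i]) (z v w : R[i]).

(** Squares instead of discs, because derivatives are only taken along the two
    coordinate axes. *)
Lemma nbhs_square z (A : set R[i]) : nbhs (z : R[i]^o) A <->
  exists2 r : R, 0 < r & forall y, `|complex.Re y - complex.Re z| < r ->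
    `|complex.Im y - complex.Im z| < r -> A y.
Proof.
split=> [/nbhs_ballP[e /= e0 He]|[r r0 Hr]].
- have eE : e = (complex.Re e)%:C by rewrite RRe_real ?gtr0_real.
  have re0 : 0 < complex.Re e by move: e0; rewrite eE ltcR.
  exists (complex.Re e / 2); first by rewrite divr_gt0.
  move=> y yr yi; apply: He; rewrite -ball_normE /= normc_def eE ltcR.
  rewrite -ltr_sqr ?nnegrE ?sqrtr_ge0 ?ltW//.
  rewrite sqr_sqrtr ?addr_ge0 ?sqr_ge0//.
  case: z y yr yi => zr zi [yr yi] /=; rewrite !ltr_norml => /andP[a b] /andP[c d].
  by nra.
- apply/nbhs_ballP; exists r%:C; rewrite /= ?ltcR// => y.
  rewrite -ball_normE /= normc_def ltcR => H.
  have {}H : (complex.Re z - complex.Re y) ^+ 2 + (complex.Im z - complex.Im y) ^+ 2 < r ^+ 2.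
    move: H; rewrite -ltr_sqr ?nnegrE ?sqrtr_ge0 ?ltW//.
    by rewrite sqr_sqrtr ?addr_ge0 ?sqr_ge0//; case: (z) y => ? ? [].
  apply: Hr; rewrite -ltr_sqr ?nnegrE ?normr_ge0 ?(ltW r0)//= real_normK ?num_real//.
  + by have := sqr_ge0 (complex.Im z - complex.Im y); nra.
  + by have := sqr_ge0 (complex.Re z - complex.Re y); nra.
Qed.

(** The real derivative at z of F along the line z + t v, taken componentwise:
    [R[i]] is a normed space over itself here, not over R. Rules for this
    predicate have names starting with [dpart]. *)
Definition is_dpart v F z (L : R[i]) :=
  is_derive (0 : R) 1 (fun t : R => complex.Re (F (z + t%:C * v))) (complex.Re L) /\
  is_derive (0 : R) 1 (fun t : R => complex.Im (F (z + t%:C * v))) (complex.Im L).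

Lemma complexReM (x y : R[i]) : complex.Re (x * y) =
  complex.Re x * complex.Re y - complex.Im x * complex.Im y.
Proof. by case: x y => ? ? []. Qed.
Lemma complexImM (x y : R[i]) : complex.Im (x * y) =
  complex.Re x * complex.Im y + complex.Im x * complex.Re y.
Proof. by case: x y => ? ? []. Qed.
Lemma complexReD (x y : R[i]) : complex.Re (x + y) = complex.Re x + complex.Re y.
Proof. by case: x y => ? ? []. Qed.
Lemma complexImD (x y : R[i]) : complex.Im (x + y) = complex.Im x + complex.Im y.
Proof. by case: x y => ? ? []. Qed.
Lemma complexReN (x : R[i]) : complex.Re (- x) = - complex.Re x.
Proof. by case: x. Qed.
Lemma complexImN (x : R[i]) : complex.Im (- x) = - complex.Im x.
Proof. by case: x. Qed.
Lemma complexReJ (x : R[i]) : complex.Re (conjc x) = complex.Re x.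
Proof. by case: x. Qed.
Lemma complexImJ (x : R[i]) : complex.Im (conjc x) = - complex.Im x.
Proof. by case: x. Qed.

Lemma conjcD (x y : R[i]) : conjc (x + y) = conjc x + conjc y.
Proof. exact: rmorphD. Qed.
Lemma conjcB (x y : R[i]) : conjc (x - y) = conjc x - conjc y.
Proof. exact: rmorphB. Qed.
Lemma conjcM (x y : R[i]) : conjc (x * y) = conjc x * conjc y.
Proof. exact: rmorphM. Qed.

Lemma complex_ext (x y : R[i]) : complex.Re x = complex.Re y ->
  complex.Im x = complex.Im y -> x = y.
Proof. by case: x y => ? ? [? ?] /= -> ->. Qed.

Lemma conjc_i : conjc ('i : R[i]) = - 'i.
Proof. by apply: complex_ext; rewrite /= ?oppr0. Qed.

Lemma line_shift z v (s t : R) : z + (s + t)%:C * v = z + s%:C * v + t%:C * v.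
Proof. by rewrite rmorphD mulrDl addrA. Qed.

Lemma line0 z v : z + 0%:C * v = z.
Proof. by rewrite mul0r addr0. Qed.

Lemma is_derive_translate (f : R -> R) (s l : R) :
  is_derive s 1 f l <-> is_derive (0 : R) 1 (fun t => f (s + t)) l.
Proof.
by split=> /is_derive_limit H; apply/is_derive_limit => e /H [r r0 Hr]; exists r => // t /Hr;
   rewrite add0r addr0.
Qed.

Lemma dpart_line v F z L (s : R) : is_dpart v F (z + s%:C * v) L <->
  is_derive s 1 (fun t : R => complex.Re (F (z + t%:C * v))) (complex.Re L) /\
  is_derive s 1 (fun t : R => complex.Im (F (z + t%:C * v))) (complex.Im L).
Proof.
have E (h : R[i] -> R) : (fun t : R => h (F (z + s%:C * v + t%:C * v))) =
    (fun t : R => h (F (z + (s + t)%:C * v))).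
  by apply/funext => t; rewrite line_shift.
have T (h : R[i] -> R) := is_derive_translate (fun t : R => h (F (z + t%:C * v))) s.
rewrite /is_dpart (E (@complex.Re R)) (E (@complex.Im R)).
by split=> -[H1 H2]; split; apply/T.
Qed.

Lemma near_on_line v z (P : R[i] -> Prop) : (\forall y \near (z : R[i]^o), P y) ->
  exists2 r : R, 0 < r & forall t : R, `|t| < r -> P (z + t%:C * v).
Proof.
move=> /nbhs_square[r r0 HP].
exists (r / (`|complex.Re v| + `|complex.Im v| + 1)) => [|t].
  by rewrite divr_gt0// ltr_pwDr// addr_ge0.
rewrite ltr_pdivlMr ?ltr_pwDr ?addr_ge0// => tr.
have H (x : R) : `|x| <= `|complex.Re v| + `|complex.Im v| -> `|t * x| < r.
  by move=> xv; apply: le_lt_trans tr; rewrite normrM ler_wpM2l//; lra.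
apply: HP; rewrite ?complexReD ?complexImD ?complexReM ?complexImM /=;
  rewrite ?mul0r ?subr0 ?addr0 addrAC subrr add0r; apply: H; rewrite ?lerDl ?lerDr//.
Qed.

Lemma dpart_near v F G z L : (\forall y \near (z : R[i]^o), F y = G y) ->
  is_dpart v F z L -> is_dpart v G z L.
Proof.
move=> /(near_on_line v)[r r0 FG].
have near_line : \forall t \near (0 : R), F (z + t%:C * v) = G (z + t%:C * v).
  by apply/nbhs_ballP; exists r => // t; rewrite -ball_normE /= sub0r normrN; exact: FG.
by move=> [H1 H2]; split; [apply: near_eq_is_derive H1|apply: near_eq_is_derive H2];
   apply: filterS near_line => t ->.
Qed.

Lemma dpart_unique v F z L L' : is_dpart v F z L -> is_dpart v F z L' -> L = L'.
Proof.
move=> [[_ A] [_ B]] [[_ C] [_ D]].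
by apply: complex_ext; [rewrite -A -C|rewrite -B -D].
Qed.

Lemma dpart_cst v (c : R[i]) z : is_dpart v (fun=> c) z 0.
Proof. by split; exact: is_derive_cst. Qed.

Lemma dpartD v F G z L M : is_dpart v F z L -> is_dpart v G z M ->
  is_dpart v (fun y => F y + G y) z (L + M).
Proof.
move=> [F1 F2] [G1 G2]; split; [under eq_fun do rewrite complexReD
  |under eq_fun do rewrite complexImD];
  by rewrite ?complexReD ?complexImD; apply: is_deriveD.
Qed.

Lemma dpartM v F G z L M : is_dpart v F z L -> is_dpart v G z M ->
  is_dpart v (fun y => F y * G y) z (L * G z + F z * M).
Proof.
move=> [F1 F2] [G1 G2]; split.
- under eq_fun do rewrite complexReM.
  apply: (is_derive_eq (is_deriveB (is_deriveM F1 G1) (is_deriveM F2 G2))).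
  rewrite !line0 complexReD !complexReM /GRing.scale /=; ring.
- under eq_fun do rewrite complexImM.
  apply: (is_derive_eq (is_deriveD (is_deriveM F1 G2) (is_deriveM F2 G1))).
  rewrite !line0 complexImD !complexImM /GRing.scale /=; ring.
Qed.

Lemma dpart_conj v F z L : is_dpart v F z L -> is_dpart v (fun y => conjc (F y)) z (conjc L).
Proof.
move=> [F1 F2]; split; [under eq_fun do rewrite complexReJ|under eq_fun do rewrite complexImJ];
  by rewrite ?complexReJ ?complexImJ //; apply: is_deriveN.
Qed.

End Complex.

(** * Wirtinger calculus *)
Section Wirtinger.
Variable R : realType.
Implicit Types (F G : R[i] -> R[i]) (z v w : R[i]).

(** p = dF/dz and q = dF/d(conj z), encoded through the derivatives along 1 and
    'i. Rules for this predicate have names starting with [wd]; they never ask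
    for more than these two directional derivatives, so they apply to functions
    that are not known to be differentiable as functions of two variables. *)
Definition is_wirtinger F z (p q : R[i]) :=
  is_dpart 1 F z (p + q) /\ is_dpart 'i F z ('i * (p - q)).

Lemma dpart_eq v F z L L' : is_dpart v F z L -> L = L' -> is_dpart v F z L'.
Proof. by move=> H <-. Qed.

Lemma wd_eq F z p q p' q' : is_wirtinger F z p q -> p = p' -> q = q' -> is_wirtinger F z p' q'.
Proof. by move=> H <- <-. Qed.

Lemma imaginary_neq0 : ('i : R[i]) != 0.
Proof. by rewrite eq_complex /= oner_eq0 andbF. Qed.

Lemma wd_of_dpart F z X Y : is_dpart 1 F z X -> is_dpart 'i F z Y ->
  is_wirtinger F z (2^-1 * (X - 'i * Y)) (2^-1 * (X + 'i * Y)).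
Proof.
move=> FX FY; split.
- by rewrite (_ : _ + _ = X)//; field.
- rewrite (_ : 'i * _ = - ('i ^+ 2) * Y); last by field.
  by rewrite sqr_i opprK mul1r.
Qed.

Lemma wd_unique F z p q p' q' : is_wirtinger F z p q -> is_wirtinger F z p' q' -> p = p' /\ q = q'.
Proof.
move=> [X Y] [X' Y'].
have E1 := dpart_unique X X'.
have E2 : p - q = p' - q'.
  by apply: (mulfI imaginary_neq0); exact: dpart_unique Y Y'.
have two : (2 : R[i]) != 0 by rewrite pnatr_eq0.
split; apply: (mulfI two).
- have -> : 2 * p = (p + q) + (p - q) by ring.
  by rewrite E1 E2; ring.
- have -> : 2 * q = (p + q) - (p - q) by ring.
  by rewrite E1 E2; ring.
Qed.

Lemma wd_near F G z p q : (\forall y \near (z : R[i]^o), F y = G y) ->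
  is_wirtinger F z p q -> is_wirtinger G z p q.
Proof. by move=> FG [X Y]; split; apply: dpart_near FG _. Qed.

Lemma wd_cst (c : R[i]) z : is_wirtinger (fun=> c) z 0 0.
Proof. by split; rewrite ?subrr ?mulr0 ?addr0; exact: dpart_cst. Qed.

Lemma wdD F G z p q p' q' : is_wirtinger F z p q -> is_wirtinger G z p' q' ->
  is_wirtinger (fun y => F y + G y) z (p + p') (q + q').
Proof.
move=> [X Y] [X' Y']; split.
- by rewrite addrACA; exact: dpartD.
- by rewrite opprD addrACA mulrDr; exact: dpartD.
Qed.

Lemma wdM F G z p q p' q' : is_wirtinger F z p q -> is_wirtinger G z p' q' ->
  is_wirtinger (fun y => F y * G y) z (p * G z + F z * p') (q * G z + F z * q').
Proof.
move=> [X Y] [X' Y']; split.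
- by apply: (dpart_eq (dpartM X X')); ring.
- by apply: (dpart_eq (dpartM Y Y')); ring.
Qed.

Lemma wdZ (c : R[i]) F z p q : is_wirtinger F z p q ->
  is_wirtinger (fun y => c * F y) z (c * p) (c * q).
Proof. by move=> H; apply: wd_eq (wdM (wd_cst c z) H) _ _; rewrite mul0r add0r. Qed.

Lemma wdN F z p q : is_wirtinger F z p q -> is_wirtinger (fun y => - F y) z (- p) (- q).
Proof.
move=> /(wdZ (-1)); rewrite !mulN1r; apply: wd_near.
by apply/nbhs_square; exists 1 => // y _ _; rewrite mulN1r.
Qed.

Lemma wdB F G z p q p' q' : is_wirtinger F z p q -> is_wirtinger G z p' q' ->
  is_wirtinger (fun y => F y - G y) z (p - p') (q - q').
Proof. by move=> H /wdN; exact: wdD. Qed.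

Lemma wd_conj F z p q : is_wirtinger F z p q ->
  is_wirtinger (fun y => conjc (F y)) z (conjc q) (conjc p).
Proof.
move=> [/dpart_conj X /dpart_conj Y]; split.
- by move: X; rewrite rmorphD addrC.
- apply: (dpart_eq Y); rewrite conjcM conjcB conjc_i.
  by rewrite mulNr -mulrN opprB.
Qed.

Lemma normC_Re (x : R[i]) : `|complex.Re x| <= normc x.
Proof. by have := normc_ge_Re x; rewrite lecR. Qed.

Lemma normC_Im (x : R[i]) : `|complex.Im x| <= normc x.
Proof. by case: x => a b /=; rewrite -sqrtr_sqr ler_wsqrtr// lerDr sqr_ge0. Qed.

Lemma normC_real (t : R) : normc t%:C = `|t|.
Proof. by rewrite /= expr0n addr0 sqrtr_sqr. Qed.

Lemma normC_ge0 (x : R[i]) : 0 <= normc x.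
Proof. by case: x => a b; exact: sqrtr_ge0. Qed.

Lemma dpart_holo (f : R[i] -> R[i]) z v : derivable (f : R[i]^o -> R[i]^o) z 1 ->
  is_dpart v f z (cderiv f z * v).
Proof.
move=> /derivableP /is_derive_limit fz.
have M0 : 0 < normc v + 1 by rewrite ltr_wpDl ?normC_ge0.
have H : forall e : R, 0 < e -> exists2 r : R, 0 < r & forall t : R, `|t| < r ->
    normc (f (z + t%:C * v) - f z - cderiv f z * (t%:C * v)) <= e * `|t|.
  move=> e e0.
  have [|r r0 Hr] := fz (e / (normc v + 1))%:C; first by rewrite ltcR divr_gt0.
  have rE : r = (complex.Re r)%:C by rewrite RRe_real ?gtr0_real.
  have re0 : 0 < complex.Re r by move: r0; rewrite rE ltcR.
  exists (complex.Re r / (normc v + 1)); first by rewrite divr_gt0.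
  move=> t; rewrite ltr_pdivlMr// => tr.
  have tv : normc (t%:C * v) = `|t| * normc v by rewrite normcM normC_real.
  have := Hr (t%:C * v).
  have -> : `|t%:C * v| < r.
    rewrite rE (_ : `|_| = (normc (t%:C * v))%:C)// ltcR tv; apply: le_lt_trans tr.
    by rewrite ler_wpM2l// lerDl.
  move=> /(_ isT).
  rewrite (_ : `|t%:C * v| = (normc (t%:C * v))%:C)// -rmorphM tv.
  rewrite (_ : `|_| = (normc (f (z + t%:C * v) - f z - cderiv f z * (t%:C * v)))%:C)// lecR.
  move/le_trans; apply; rewrite [leLHS](_ : _ = e * `|t| * (normc v / (normc v + 1))); last by ring.
  by rewrite ler_piMr ?mulr_ge0 ?(ltW e0)// ler_pdivrMr// mul1r lerDl.
split; apply/is_derive_limit => e e0; have [r r0 Hr] := H e e0; exists r => // t tr;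
  apply: le_trans (Hr t tr).
- apply: le_trans (normC_Re _); rewrite add0r line0 !complexReD !complexReN.
  by rewrite le_eqVlt; apply/orP; left; apply/eqP; congr `|_ - _|;
    rewrite mulrCA [in RHS]complexReM /= mul0r subr0 mulrC.
- apply: le_trans (normC_Im _); rewrite add0r line0 !complexImD !complexImN.
  by rewrite le_eqVlt; apply/orP; left; apply/eqP; congr `|_ - _|;
    rewrite mulrCA [in RHS]complexImM /= mul0r addr0 mulrC.
Qed.

Lemma wd_holo (f : R[i] -> R[i]) z : derivable (f : R[i]^o -> R[i]^o) z 1 ->
  is_wirtinger f z (cderiv f z) 0.
Proof.
move=> fz; split; have := dpart_holo _ fz.
- by move=> /(_ 1); rewrite mulr1 addr0.
- by move=> /(_ 'i); rewrite subr0 mulrC.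
Qed.

Definition cts F z := {for z, continuous (F : R[i]^o -> R[i]^o)}.

Lemma cts_square F z : cts F z <-> forall e : R, 0 < e -> exists2 r : R, 0 < r &
  forall y, `|complex.Re y - complex.Re z| < r -> `|complex.Im y - complex.Im z| < r ->
    `|complex.Re (F y) - complex.Re (F z)| < e /\
    `|complex.Im (F y) - complex.Im (F z)| < e.
Proof.
split=> [Fz e e0|H A /nbhs_square[e e0 He]].
- have /Fz/nbhs_square[r r0 Hr] : nbhs (F z : R[i]^o) [set y |
    `|complex.Re y - complex.Re (F z)| < e /\ `|complex.Im y - complex.Im (F z)| < e].
    by apply/nbhs_square; exists e.
  by exists r.
- have [r r0 Hr] := H e e0; apply/nbhs_square; exists r => // y yr yi.
  by have [] := Hr y yr yi; exact: He.
Qed.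

Lemma cts_cst (c : R[i]) z : cts (fun=> c) z.
Proof. exact: cst_continuous. Qed.
Arguments cts_cst : clear implicits.
Lemma ctsD F G z : cts F z -> cts G z -> cts (fun y => F y + G y) z.
Proof. exact: continuousD. Qed.
Lemma ctsN F z : cts F z -> cts (fun y => - F y) z.
Proof. exact: continuousN. Qed.
Lemma ctsB F G z : cts F z -> cts G z -> cts (fun y => F y - G y) z.
Proof. exact: continuousB. Qed.
Lemma ctsM F G z : cts F z -> cts G z -> cts (fun y => F y * G y) z.
Proof. exact: continuousM. Qed.
Lemma ctsZ (c : R[i]) F z : cts F z -> cts (fun y => c * F y) z.
Proof. exact: (ctsM (cts_cst c z)). Qed.
Lemma ctsV F z : F z != 0 -> cts F z -> cts (fun y => (F y)^-1) z.
Proof. exact: continuousV. Qed.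
Lemma cts_conj F z : cts F z -> cts (fun y => conjc (F y)) z.
Proof.
move=> /cts_square H; apply/cts_square => e /H[r r0 Hr]; exists r => // y yr yi.
have [A B] := Hr y yr yi; cbv beta; rewrite !complexReJ !complexImJ.
by rewrite -opprD normrN.
Qed.
Lemma cts_near F G z : (\forall y \near (z : R[i]^o), F y = G y) -> cts F z -> cts G z.
Proof.
move=> FG Fz A GA.
have FA : nbhs (F z : R[i]^o) A by move: GA; have -> := nbhs_singleton FG.
by apply: filterS2 FG (Fz A FA) => y /= ->.
Qed.
Lemma cts_holo (f : R[i] -> R[i]) z : derivable (f : R[i]^o -> R[i]^o) z 1 -> cts f z.
Proof. by move=> /derivable1_diffP/differentiable_continuous. Qed.

Lemma dpart_schwarz F P S PS SP z :
  (\forall y \near (z : R[i]^o),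
    [/\ is_dpart 1 F y (P y), is_dpart 'i F y (S y), is_dpart 'i P y (PS y) &
        is_dpart 1 S y (SP y)]) ->
  cts PS z -> cts SP z -> PS z = SP z.
Proof.
move=> /nbhs_square[r r0 D] PSc SPc.
pose pt (s t : R) := z + s%:C * 1 + t%:C * 'i.
have ptC s t : pt s t = z + t%:C * 'i + s%:C * 1 by rewrite /pt addrAC.
have Rept s t : complex.Re (pt s t) - complex.Re z = s.
  by rewrite /pt !complexReD !complexReM /= !(mul0r, mulr0, mulr1, subr0, addr0) addrC addKr.
have Impt s t : complex.Im (pt s t) - complex.Im z = t.
  by rewrite /pt !complexImD !complexImM /= !(mul0r, mulr0, mulr1, subr0, addr0) addrC addKr.
have Dpt (s t : R) : `|s| < r -> `|t| < r -> [/\ is_dpart 1 F (pt s t) (P (pt s t)),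
    is_dpart 'i F (pt s t) (S (pt s t)), is_dpart 'i P (pt s t) (PS (pt s t)) &
    is_dpart 1 S (pt s t) (SP (pt s t))].
  by move=> sr tr; apply: D; rewrite ?Rept ?Impt.
have horiz (K L : R[i] -> R[i]) s t : is_dpart 1 K (pt s t) (L (pt s t)) ->
    is_derive s 1 (fun s => complex.Re (K (pt s t))) (complex.Re (L (pt s t))) /\
    is_derive s 1 (fun s => complex.Im (K (pt s t))) (complex.Im (L (pt s t))).
  by rewrite ptC => /dpart_line[]; under eq_fun do rewrite -ptC;
    under [X in _ -> is_derive _ _ X _ -> _]eq_fun do rewrite -ptC.
have vert (K L : R[i] -> R[i]) s t : is_dpart 'i K (pt s t) (L (pt s t)) ->
    is_derive t 1 (fun t => complex.Re (K (pt s t))) (complex.Re (L (pt s t))) /\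
    is_derive t 1 (fun t => complex.Im (K (pt s t))) (complex.Im (L (pt s t))).
  by move=> /dpart_line.
have pt0 : pt 0 0 = z by rewrite /pt !mul0r !addr0.
have ctspt (K : R[i] -> R[i]) : cts K z -> forall e : R, 0 < e -> exists2 d : R, 0 < d &
    forall s t : R, `|s| < d -> `|t| < d ->
    `|complex.Re (K (pt s t)) - complex.Re (K (pt 0 0))| < e /\
    `|complex.Im (K (pt s t)) - complex.Im (K (pt 0 0))| < e.
  move=> /cts_square Kc e /Kc[d d0 Hd]; exists d => // s t sd td.
  by rewrite pt0; apply: Hd; rewrite ?Rept ?Impt.
rewrite -pt0; apply: complex_ext.
- apply: (@schwarz R (fun s t => complex.Re (F (pt s t))) (fun s t => complex.Re (P (pt s t)))
    (fun s t => complex.Re (S (pt s t))) (fun s t => complex.Re (PS (pt s t)))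
    (fun s t => complex.Re (SP (pt s t))) r r0).
  + by move=> s t sr tr; have [/horiz[]] := Dpt s t sr tr.
  + by move=> s t sr tr; have [_ /vert[]] := Dpt s t sr tr.
  + by move=> s t sr tr; have [_ _ /vert[]] := Dpt s t sr tr.
  + by move=> s t sr tr; have [_ _ _ /horiz[]] := Dpt s t sr tr.
  + by move=> e /(ctspt _ PSc)[d d0 Hd]; exists d => // s t sd td; have [] := Hd s t sd td.
  + by move=> e /(ctspt _ SPc)[d d0 Hd]; exists d => // s t sd td; have [] := Hd s t sd td.
- apply: (@schwarz R (fun s t => complex.Im (F (pt s t))) (fun s t => complex.Im (P (pt s t)))
    (fun s t => complex.Im (S (pt s t))) (fun s t => complex.Im (PS (pt s t)))
    (fun s t => complex.Im (SP (pt s t))) r r0).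
  + by move=> s t sr tr; have [/horiz[]] := Dpt s t sr tr.
  + by move=> s t sr tr; have [_ /vert[]] := Dpt s t sr tr.
  + by move=> s t sr tr; have [_ _ /vert[]] := Dpt s t sr tr.
  + by move=> s t sr tr; have [_ _ _ /horiz[]] := Dpt s t sr tr.
  + by move=> e /(ctspt _ PSc)[d d0 Hd]; exists d => // s t sd td; have [] := Hd s t sd td.
  + by move=> e /(ctspt _ SPc)[d d0 Hd]; exists d => // s t sd td; have [] := Hd s t sd td.
Qed.

(** The substitute for Goursat's theorem: if the derivative f of a holomorphic F
    has continuous partial derivatives, then f satisfies the Cauchy-Riemann
    equation, for this equation is the equality of the two mixed second
    derivatives of F, whose first derivatives are f and 'i f. *)
Lemma holo_derivative_holo F f p q z :
  (\forall y \near (z : R[i]^o), is_wirtinger F y (f y) 0 /\ is_wirtinger f y (p y) (q y)) ->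
  cts p z -> cts q z -> q z = 0.
Proof.
move=> D pc qc.
have : 'i * (p z - q z) = 'i * (p z + q z).
  apply: (@dpart_schwarz F f (fun y => 'i * f y) (fun y => 'i * (p y - q y))
    (fun y => 'i * (p y + q y))).
  - apply: filterS D => y [[X Y] [X' Y']]; split => //.
    + by rewrite addr0 in X.
    + by rewrite subr0 in Y.
    + by apply: (dpart_eq (dpartM (dpart_cst 1 'i y) X')); rewrite mul0r add0r.
  - by apply: ctsM; [exact: cts_cst|exact: ctsB].
  - by apply: ctsM; [exact: cts_cst|exact: ctsD].
move=> /(mulfI imaginary_neq0)/eqP.
by rewrite eq_sym -subr_eq0 (_ : _ - _ = 2 * q z) ?mulf_eq0 ?pnatr_eq0 /= => [/eqP//|]; ring.
Qed.

Lemma dpart0_const v F z (t : R) :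
  (forall s : R, `|s| <= `|t| -> is_dpart v F (z + s%:C * v) 0) -> F (z + t%:C * v) = F z.
Proof.
move=> D; rewrite -[in RHS](line0 z v).
by apply: complex_ext;
  [apply: (@zero_derivative_constant R (fun t => complex.Re (F (z + t%:C * v))))
  |apply: (@zero_derivative_constant R (fun t => complex.Im (F (z + t%:C * v))))] => s;
  rewrite !subr0 => /D/dpart_line[].
Qed.

Lemma wd0_const F z (r : R) :
  (forall y, `|complex.Re y - complex.Re z| < r -> `|complex.Im y - complex.Im z| < r ->
    is_wirtinger F y 0 0) ->
  forall y, `|complex.Re y - complex.Re z| < r -> `|complex.Im y - complex.Im z| < r ->
    F y = F z.
Proof.
move=> D y yr yi.
set s := complex.Re y - complex.Re z in yr; set t := complex.Im y - complex.Im z in yi.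
have yE : y = z + s%:C * 1 + t%:C * 'i.
  apply: complex_ext.
  - by rewrite !complexReD !complexReM /= /s; ring.
  - by rewrite !complexImD !complexImM /= /t; ring.
have r0 : 0 < r := le_lt_trans (normr_ge0 _) yr.
have -> : F y = F (z + s%:C * 1).
  rewrite yE; apply: dpart0_const => x xt.
  have [||_] := D (z + s%:C * 1 + x%:C * 'i); last by rewrite subr0 mulr0.
  + by rewrite !complexReD !complexReM /= !(mul0r, mulr0, mulr1, subr0, addr0) addrC addKr.
  + by rewrite !complexImD !complexImM /= !(mul0r, mulr0, mulr1, addr0) addrC addKr (le_lt_trans xt).
apply: dpart0_const.
- move=> x xs; have [||+ _] := D (z + x%:C * 1); last by rewrite addr0.
  + by rewrite complexReD complexReM /= !(mul0r, mulr0, mulr1, subr0) addrC addKr (le_lt_trans xs).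
  + by rewrite complexImD complexImM /= !(mul0r, mulr0, addr0) subrr normr0.
Qed.

End Wirtinger.

Arguments cts_cst {R} c z.

(** * From real coordinates to Wirtinger derivatives *)
Lemma det_mx2 (K : comPzRingType) (M : 'M[K]_2) :
  \det M = M 0 0 * M 1 1 - M 0 1 * M 1 0.
Proof.
rewrite (expand_det_row _ 0) !big_ord_recl big_ord0 addr0 /cofactor !det_mx11 !mxE /=.
rewrite expr0 mul1r expr1 mulN1r mulrN.
by congr (_ * M _ _ - M _ _ * M _ _); apply: val_inj.
Qed.

Section RealCoordinates.
Variable R : realType.

(** Q, S and T are dg/d(conj z), a quarter of the Laplacian of g, and
    d^2 g/d(conj z)^2. That S is real is the symmetry of second derivatives. *)
Definition C2_on (O : set R[i]) (g : R[i] -> R) (Q S T : R[i] -> R[i]) :=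
  forall z, O z -> [/\ is_wirtinger (fun y => (g y)%:C) z (conjc (Q z)) (Q z),
    is_wirtinger Q z (S z) (T z), cts Q z, cts S z & cts T z] /\ conjc (S z) = S z.

Lemma derive_line n (G : 'rV[R]_n -> R) p v :
  'D_v G p = 'D_1 (fun t : R => G (p + t *: v)) 0.
Proof.
rewrite /derive; set g1 := fun h => h^-1 *: _; set g2 := fun h => h^-1 *: _.
suff -> : g1 = g2 by [].
apply/funext => h; rewrite /g1 /g2 /=.
by rewrite addr0 scale0r addr0 [h *: 1]mulr1 (addrC p).
Qed.

Lemma is_derive_line n (G : 'rV[R]_n -> R) p v : derivable G p v ->
  is_derive (0 : R) 1 (fun t : R => G (p + t *: v)) ('D_v G p).
Proof.
move=> Gp; apply: DeriveDef; last by rewrite derive_line.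
move: Gp; rewrite /derivable; set g1 := fun h => h^-1 *: _; set g2 := fun h => h^-1 *: _.
suff -> : g1 = g2 by [].
apply/funext => h; rewrite /g1 /g2 /=.
by rewrite addr0 scale0r addr0 [h *: 1]mulr1 (addrC p).
Qed.

Lemma C2_of_partials (O : set R[i]^o) (g gx gy gxx gxy gyx gyy : R[i] -> R) :
  open O ->
  (forall z, O z -> [/\ is_dpart 1 (fun y => (g y)%:C) z (gx z)%:C,
    is_dpart 'i (fun y => (g y)%:C) z (gy z)%:C &
    cts (fun y => (gx y)%:C) z /\ cts (fun y => (gy y)%:C) z]) ->
  (forall z, O z -> [/\ is_dpart 1 (fun y => (gx y)%:C) z (gxx z)%:C,
    is_dpart 'i (fun y => (gx y)%:C) z (gxy z)%:C,
    is_dpart 1 (fun y => (gy y)%:C) z (gyx z)%:C &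
    is_dpart 'i (fun y => (gy y)%:C) z (gyy z)%:C]) ->
  (forall z, O z -> [/\ cts (fun y => (gxx y)%:C) z, cts (fun y => (gxy y)%:C) z,
    cts (fun y => (gyx y)%:C) z & cts (fun y => (gyy y)%:C) z]) ->
  exists Q S T, C2_on O g Q S T.
Proof.
move=> openO D1 D2 D3.
have sym z : O z -> gxy z = gyx z.
  move=> Oz; suff : (gxy z)%:C = (gyx z)%:C by move/complexI.
  have [_ c1 c2 _] := D3 z Oz.
  apply: (@dpart_schwarz R (fun y => (g y)%:C) (fun y => (gx y)%:C) (fun y => (gy y)%:C)
    (fun y => (gxy y)%:C) (fun y => (gyx y)%:C)) => //.
  have : \forall y \near (z : R[i]^o), O y by apply: open_nbhs_nbhs.
  by apply: filterS => y Oy; have [? ? _] := D1 y Oy; have [? ? ? ?] := D2 y Oy.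
pose Q y := 2^-1 * ((gx y)%:C + 'i * (gy y)%:C).
pose X y := 2^-1 * ((gxx y)%:C + 'i * (gyx y)%:C).
pose Y y := 2^-1 * ((gxy y)%:C + 'i * (gyy y)%:C).
exists Q, (fun y => 2^-1 * (X y - 'i * Y y)), (fun y => 2^-1 * (X y + 'i * Y y)).
have comb (h k : R[i] -> R) z : cts (fun y => (h y)%:C) z -> cts (fun y => (k y)%:C) z ->
    cts (fun y => 2^-1 * ((h y)%:C + 'i * (k y)%:C)) z.
  by move=> hc kc; apply/ctsZ/(ctsD hc)/ctsZ.
have dcomb v (h k : R[i] -> R) z a b : is_dpart v (fun y => (h y)%:C) z a ->
    is_dpart v (fun y => (k y)%:C) z b ->
    is_dpart v (fun y => 2^-1 * ((h y)%:C + 'i * (k y)%:C)) z (2^-1 * (a + 'i * b)).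
  move=> hd kd; have := dpartM (dpart_cst v 2^-1 z) (dpartD hd (dpartM (dpart_cst v 'i z) kd)).
  by move/dpart_eq; apply; rewrite !mul0r !add0r.
move=> z Oz; have [gxP gyP [gxc gyc]] := D1 z Oz; have [xx xy yx yy] := D2 z Oz.
have [cxx cxy cyx cyy] := D3 z Oz.
have cX : cts X z by exact: comb.
have cY : cts Y z by exact: comb.
have ciY : cts (fun y => 'i * Y y) z by exact: ctsZ.
split; first split.
- apply: wd_eq (wd_of_dpart gxP gyP) _ _ => //.
  by rewrite /Q conjcM conjcD conjcM !conjc_real conjc_i conjc_inv conjc_nat mulNr.
- by apply: wd_of_dpart; exact: dcomb.
- exact: comb.
- by apply/ctsZ/ctsB.
- by apply/ctsZ/ctsD.
- rewrite (_ : 2^-1 * _ = ((gxx z + gyy z) / 4)%:C) ?conjc_real//.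
  rewrite /X /Y sym// [LHS](_ : _ = 4^-1 * ((gxx z)%:C - 'i ^+ 2 * (gyy z)%:C)); last by field.
  by rewrite sqr_i mulN1r opprK mulrC rmorphM fmorphV rmorphD /= rmorph_nat.
Qed.

(** P is an affine parametrization of a complex line by its real coordinates
    i and j. *)
Lemma smooth_C2 n (A : set 'rV[R]_n) (f : 'rV[R]_n -> R) (P : R[i] -> 'rV[R]_n) i j
    (O : set R[i]^o) :
  (forall z (t : R), P (z + t%:C * 1) = P z + t *: delta_mx 0 i) ->
  (forall z (t : R), P (z + t%:C * 'i) = P z + t *: delta_mx 0 j) ->
  Ck_on A 2 f -> open O -> (forall z, O z -> A (P z)) ->
  exists Q S T, C2_on O (fun z => f (P z)) Q S T.
Proof.
move=> Pi Pj [_ fC] openO OA.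
have PE z y : P y = P z + (complex.Re y - complex.Re z) *: delta_mx 0 i
    + (complex.Im y - complex.Im z) *: delta_mx 0 j.
  rewrite -Pi -Pj; congr P; apply: complex_ext.
  - by rewrite !complexReD !complexReM /=; ring.
  - by rewrite !complexImD !complexImM /=; ring.
have comp (G : 'rV[R]_n -> R) z : {for P z, continuous G} -> cts (fun y => (G (P y))%:C) z.
  move=> Gc; apply/cts_square => e e0.
  have /nbhs_ballP[d /= d0 Hd] : \forall p \near P z, `|G (P z) - G p| < e.
    by have /cvgrPdist_lt /(_ e e0) := Gc.
  pose M := `|delta_mx 0 i : 'rV[R]_n| + `|delta_mx 0 j : 'rV[R]_n| + 1.
  have M0 : 0 < M by rewrite ltr_wpDl// addr_ge0.
  exists (d / M) => [|y]; first by rewrite divr_gt0.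
  rewrite !ltr_pdivlMr// => yr yi; split; last by rewrite /= subrr normr0.
  rewrite /= distrC; apply: Hd; rewrite -ball_normE /= (PE z y) -addrA opprD addrA subrr add0r normrN.
  rewrite (le_lt_trans (ler_normD _ _))// !normrZ.
  set a := `|complex.Re y - _| in yr *; set b := `|complex.Im y - _| in yi *.
  have a0 : 0 <= a by exact: normr_ge0.
  have b0 : 0 <= b by exact: normr_ge0.
  have m1 : 0 <= `|delta_mx 0 i : 'rV[R]_n| by exact: normr_ge0.
  have m2 : 0 <= `|delta_mx 0 j : 'rV[R]_n| by exact: normr_ge0.
  move: yr yi; rewrite /M; set u := `|_ i| in m1 *; set v := `|_ j| in m2 *.
  rewrite !mulrDr !mulr1 => yr yi; have [ab|ba] := leP a b.
  - by have := ler_wpM2r m1 ab; lra.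
  - by have := ler_wpM2r m2 (ltW ba); lra.
have partial v k (G : 'rV[R]_n -> R) z :
    (forall z (t : R), P (z + t%:C * v) = P z + t *: delta_mx 0 k) ->
    derivable G (P z) (delta_mx 0 k) ->
    is_dpart v (fun y => (G (P y))%:C) z ('D_(delta_mx 0 k) G (P z))%:C.
  move=> Pk Gd; split; last by apply: is_derive_cst.
  by under eq_fun do rewrite Pk; exact: is_derive_line.
have [fi [fic fiC]] := fC i; have [fj [fjc fjC]] := fC j.
have [fii [fiic _]] := fiC i; have [fij [fijc _]] := fiC j.
have [fji [fjic _]] := fjC i; have [fjj [fjjc _]] := fjC j.
pose fi' := 'D_(delta_mx 0 i) f; pose fj' := 'D_(delta_mx 0 j) f.
apply: (@C2_of_partials O (fun y => f (P y)) (fun y => fi' (P y)) (fun y => fj' (P y))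
  (fun y => 'D_(delta_mx 0 i) fi' (P y)) (fun y => 'D_(delta_mx 0 j) fi' (P y))
  (fun y => 'D_(delta_mx 0 i) fj' (P y)) (fun y => 'D_(delta_mx 0 j) fj' (P y)) openO) => z /OA Az.
- split; [exact: partial Pi (fi _ Az)|exact: partial Pj (fj _ Az)|].
  by split; [exact: comp (fic _ Az)|exact: comp (fjc _ Az)].
- split; [exact: partial Pi (fii _ Az)|exact: partial Pj (fij _ Az)|..].
  + exact: partial Pi (fji _ Az).
  + exact: partial Pj (fjj _ Az).
- split; [exact: comp (fiic _ Az)|exact: comp (fijc _ Az)|..].
  + exact: comp (fjic _ Az).
  + exact: comp (fjjc _ Az).
Qed.

Lemma to_realK m (x : 'rV[R[i]]_m) : of_real (to_real x) = x.
Proof.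
apply/rowP => j; rewrite mxE /to_real row_mxEl row_mxEr !mxE; exact: complex_ext.
Qed.

Lemma to_real_shift m (x : 'rV[R[i]]_m) j (t : R) :
  to_real (x + (t%:C * 1) *: delta_mx 0 j) = to_real x + t *: delta_mx 0 (lshift m j).
Proof.
apply/rowP => k; rewrite /to_real -[k]splitK; case: (fintype.split k) => l /=.
- rewrite [RHS]mxE !row_mxEl !mxE /= eq_lshift complexReD complexReM /=.
  by rewrite !(mul0r, mulr1, mulr0, subr0); case: (l == j); rewrite /= ?mulr1 ?mulr0 ?subr0.
- rewrite [RHS]mxE !row_mxEr !mxE /= eq_rlshift complexImD complexImM /=.
  by case: (l == j); rewrite /= !(mul0r, mulr1, mulr0, addr0).
Qed.

Lemma to_real_shifti m (x : 'rV[R[i]]_m) j (t : R) :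
  to_real (x + (t%:C * 'i) *: delta_mx 0 j) = to_real x + t *: delta_mx 0 (rshift m j).
Proof.
apply/rowP => k; rewrite /to_real -[k]splitK; case: (fintype.split k) => l /=.
- rewrite [RHS]mxE !row_mxEl !mxE /= eq_lrshift complexReD complexReM /=.
  by case: (l == j); rewrite /= !(mul0r, mulr1, mulr0, addr0, subr0).
- rewrite [RHS]mxE !row_mxEr !mxE /= eq_rshift complexImD complexImM /=.
  by case: (l == j); rewrite /= !(mul0r, mulr1, mulr0, addr0, add0r, subr0).
Qed.

Lemma real_partialE m (F : 'rV[R[i]]_m -> R[i]) x j k v L :
  (forall t : R, to_real (x + (t%:C * v) *: delta_mx 0 j) = to_real x + t *: delta_mx 0 k) ->
  is_dpart v (fun y => F (x + y *: delta_mx 0 j)) 0 L -> real_partial k F x = L.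
Proof.
move=> xk [[_ L1] [_ L2]]; rewrite /real_partial !derive_line.
rewrite (_ : (fun t : R => complex.Re (F (of_real (to_real x + t *: delta_mx 0 k)))) =
  (fun t : R => complex.Re (F (x + (0 + t%:C * v) *: delta_mx 0 j)))); last first.
  by apply/funext => t; rewrite -xk to_realK add0r.
rewrite (_ : (fun t : R => complex.Im (F (of_real (to_real x + t *: delta_mx 0 k)))) =
  (fun t : R => complex.Im (F (x + (0 + t%:C * v) *: delta_mx 0 j)))); last first.
  by apply/funext => t; rewrite -xk to_realK add0r.
by rewrite L1 L2; case: (L).
Qed.

(** The operators in the variable of index j only see the complex line through
    x in the direction j, so the one-variable calculus computes them. *)
Lemma wirtingerE m (F : 'rV[R[i]]_m -> R[i]) x j p q :
  is_wirtinger (fun y => F (x + y *: delta_mx 0 j)) 0 p q ->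
  wirtinger j F x = p /\ wirtinger_bar j F x = q.
Proof.
move=> [/(real_partialE (to_real_shift x j)) E1 /(real_partialE (to_real_shifti x j)) E2].
by rewrite /wirtinger /wirtinger_bar E1 E2 mulrA -expr2 sqr_i mulN1r; split; field.
Qed.

Lemma wd_translate (F : R[i] -> R[i]) z p q : is_wirtinger F z p q ->
  is_wirtinger (fun y => F (z + y)) 0 p q.
Proof.
by move=> [[? ?] [? ?]]; split; split; under eq_fun do rewrite add0r.
Qed.

Definition pair_row (z w : R[i]) : 'rV[R[i]]_2 := \row_j (if j == 0 then z else w).

Lemma pair_row_fst z w : pair_row z w 0 0 = z.
Proof. by rewrite mxE. Qed.

Lemma pair_row_snd z w : pair_row z w 0 1 = w.
Proof. by rewrite mxE. Qed.

Lemma pair_row_shift0 z w y : pair_row z w + y *: delta_mx 0 0 = pair_row (z + y) w.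
Proof.
by apply/rowP => j; rewrite !mxE /= ; case: (j == 0); rewrite /= ?mulr1 ?mulr0 ?addr0.
Qed.

Lemma pair_row_shift1 z w y : pair_row z w + y *: delta_mx 0 1 = pair_row z (w + y).
Proof.
apply/rowP => j; rewrite !mxE /=; case: (unliftP 0 j) => [k|] ->.
  by rewrite ord1 /= mulr1.
by rewrite /= mulr0 addr0.
Qed.

Lemma wirtinger_fst (F : 'rV[R[i]]_2 -> R[i]) z w p q :
  is_wirtinger (fun y => F (pair_row y w)) z p q ->
  wirtinger 0 F (pair_row z w) = p /\ wirtinger_bar 0 F (pair_row z w) = q.
Proof.
move=> /wd_translate H; apply: wirtingerE.
by move: H; congr is_wirtinger; apply/funext => y; rewrite pair_row_shift0.
Qed.

Lemma wirtinger_snd (F : 'rV[R[i]]_2 -> R[i]) z w p q :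
  is_wirtinger (fun y => F (pair_row z y)) w p q ->
  wirtinger 1 F (pair_row z w) = p /\ wirtinger_bar 1 F (pair_row z w) = q.
Proof.
move=> /wd_translate H; apply: wirtingerE.
by move: H; congr is_wirtinger; apply/funext => y; rewrite pair_row_shift1.
Qed.

Lemma det_complex_hessian2 (U V : set R[i]^o) (u : R[i] -> R[i] -> R)
    (B0 B1 : R[i] -> R[i] -> R[i]) z w e00 e01 e10 e11 q00 q01 q10 q11 :
  open U -> open V -> U z -> V w ->
  (forall y x, U y -> V x -> exists p, is_wirtinger (fun y => (u y x)%:C) y p (B0 y x)) ->
  (forall y x, U y -> V x -> exists p, is_wirtinger (fun x => (u y x)%:C) x p (B1 y x)) ->
  is_wirtinger (fun y => B0 y w) z e00 q00 -> is_wirtinger (fun y => B1 y w) z e01 q01 ->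
  is_wirtinger (fun x => B0 z x) w e10 q10 -> is_wirtinger (fun x => B1 z x) w e11 q11 ->
  \det (complex_hessian2 u z w) = e00 * e11 - e01 * e10.
Proof.
move=> oU oV Uz Vw uB0 uB1 H00 H01 H10 H11.
have nU : \forall y \near (z : R[i]^o), U y by apply: open_nbhs_nbhs.
have nV : \forall y \near (w : R[i]^o), V y by apply: open_nbhs_nbhs.
pose f := fun y : 'rV[R[i]]_2 => (u (y 0 0) (y 0 1))%:C.
have W0 y x : U y -> V x -> wirtinger_bar 0 f (pair_row y x) = B0 y x.
  move=> Uy Vx; have [p H] := uB0 y x Uy Vx.
  have [|_ //] := @wirtinger_fst f y x p (B0 y x).
  by rewrite /f; under eq_fun do rewrite pair_row_fst pair_row_snd.
have W1 y x : U y -> V x -> wirtinger_bar 1 f (pair_row y x) = B1 y x.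
  move=> Uy Vx; have [p H] := uB1 y x Uy Vx.
  have [|_ //] := @wirtinger_snd f y x p (B1 y x).
  by rewrite /f; under eq_fun do rewrite pair_row_fst pair_row_snd.
have E00 : complex_hessian2 u z w 0 0 = e00.
  rewrite mxE; apply: (proj1 (@wirtinger_fst _ z w e00 q00 _)).
  by apply: wd_near H00; apply: filterS nU => y Uy; rewrite W0.
have E01 : complex_hessian2 u z w 0 1 = e01.
  rewrite mxE; apply: (proj1 (@wirtinger_fst _ z w e01 q01 _)).
  by apply: wd_near H01; apply: filterS nU => y Uy; rewrite W1.
have E10 : complex_hessian2 u z w 1 0 = e10.
  rewrite mxE; apply: (proj1 (@wirtinger_snd _ z w e10 q10 _)).
  by apply: wd_near H10; apply: filterS nV => y Uy; rewrite W0.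
have E11 : complex_hessian2 u z w 1 1 = e11.
  rewrite mxE; apply: (proj1 (@wirtinger_snd _ z w e11 q11 _)).
  by apply: wd_near H11; apply: filterS nV => y Uy; rewrite W1.
by rewrite det_mx2 E00 E01 E10 E11.
Qed.

Lemma smooth2_C2 (U V : set R[i]^o) (u : R[i] -> R[i] -> R) w : open U -> V w ->
  smooth_on2 U V u -> exists Q S T, C2_on U (fun z => u z w) Q S T.
Proof.
move=> oU Vw /(_ 2) uC.
have [||z Uz|Q [S [T H]]] := smooth_C2 (P := fun z => to_real (pair_row z w))
  (i := lshift 2 0) (j := rshift 2 0) (O := U) _ _ uC oU.
- by move=> z t; rewrite -pair_row_shift0 to_real_shift.
- by move=> z t; rewrite -pair_row_shift0 to_real_shifti.
- by rewrite /= to_realK pair_row_fst pair_row_snd; split.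
- exists Q, S, T; move: H; congr C2_on; apply/funext => z.
  by rewrite to_realK pair_row_fst pair_row_snd.
Qed.

Lemma smooth1_C2 (V : set R[i]^o) (f : R[i] -> R) : open V ->
  smooth_on1 V f -> exists Q S T, C2_on V f Q S T.
Proof.
move=> oV /(_ 2) fC.
have [||z Vz|Q [S [T H]]] := smooth_C2 (P := fun z => to_real (\row_(j < 1) z))
  (i := lshift 1 0) (j := rshift 1 0) (O := V) _ _ fC oV.
- move=> z t; rewrite -to_real_shift; congr to_real; apply/rowP => j.
  by rewrite !mxE !ord1 /= !mulr1.
- move=> z t; rewrite -to_real_shifti; congr to_real; apply/rowP => j.
  by rewrite !mxE !ord1 /= !mulr1.
- by rewrite /= to_realK mxE.
- by exists Q, S, T; move: H; congr C2_on; apply/funext => z; rewrite to_realK mxE.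
Qed.

End RealCoordinates.

(** * Inverses, and second-order expansions at a critical point *)
Section Inverse.
Variable R : realType.

Lemma dpart_realV v (n : R[i] -> R) z (l : R) : n z != 0 ->
  is_dpart v (fun y => (n y)%:C) z l%:C ->
  is_dpart v (fun y => ((n y)^-1)%:C) z (- (n z) ^- 2 * l)%:C.
Proof.
move=> nz [[D E] _]; split; last exact: is_derive_cst.
have n0 : n (z + 0%:C * v) != 0 by rewrite line0.
apply: DeriveDef; first exact: derivableV.
by rewrite deriveV// E line0.
Qed.

(** Reduced to the inverse of a real function by 1 / F = conj F / |F|^2. *)
Lemma dpartV v (F : R[i] -> R[i]) z L : F z != 0 -> is_dpart v F z L ->
  is_dpart v (fun y => (F y)^-1) z (- (F z) ^- 2 * L).
Proof.
move=> Fz D; pose n y := complex.Re (F y) ^+ 2 + complex.Im (F y) ^+ 2.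
have nE y : (n y)%:C = F y * conjc (F y) by rewrite /n add_Re2_Im2 sqr_normc.
have VE y : (F y)^-1 = conjc (F y) * ((n y)^-1)%:C.
  by rewrite invc_norm mulrC -add_Re2_Im2 fmorphV.
have nz : n z != 0.
  by apply: contraNneq Fz => n0; have := nE z; rewrite n0 => /esym/eqP;
     rewrite mulf_eq0 conjc_eq0 orbb.
pose l := complex.Re (L * conjc (F z) + F z * conjc L).
have lE : L * conjc (F z) + F z * conjc L = l%:C.
  apply: complex_ext => //=; rewrite !(complexImD, complexImM, complexReJ, complexImJ); ring.
have nD : is_dpart v (fun y => (n y)%:C) z l%:C.
  by rewrite -lE; under eq_fun do rewrite nE; exact: dpartM (dpart_conj D).
under eq_fun do rewrite VE.
apply: dpart_eq (dpartM (dpart_conj D) (dpart_realV nz nD)) _.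
have -> : (- n z ^- 2 * l)%:C = - (n z)%:C ^- 2 * l%:C by rewrite rmorphM rmorphN fmorphV rmorphXn.
have -> : ((n z)^-1)%:C = (n z)%:C^-1 by rewrite fmorphV.
rewrite -lE nE.
have Fz' : conjc (F z) != 0 by rewrite conjc_eq0.
by field; rewrite Fz Fz'.
Qed.

Lemma wdV (F : R[i] -> R[i]) z p q : F z != 0 -> is_wirtinger F z p q ->
  is_wirtinger (fun y => (F y)^-1) z (- (F z) ^- 2 * p) (- (F z) ^- 2 * q).
Proof.
move=> Fz [X Y]; split.
- by rewrite -mulrDr; exact: dpartV.
- by rewrite -mulrBr mulrCA; exact: dpartV.
Qed.

(** Taylor's formula with Peano's remainder: the second derivative need only
    exist at the point itself. *)
Lemma peano2 (g g1 : R -> R) (m r : R) : 0 < r ->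
  (forall t : R, `|t| < r -> is_derive t 1 g (g1 t)) -> g1 0 = 0 ->
  is_derive (0 : R) 1 g1 m ->
  (fun t : R => (g t - g 0) / t ^+ 2) @ 0^' --> m / 2.
Proof.
move=> r0 gD g10 /is_derive_limit g1D; apply/cvgrPdist_le => e e0.
have [d d0 Hd] := g1D e e0; rewrite near_withinE.
have rd0 : 0 < Num.min r d by rewrite lt_min r0.
apply/nbhs_ballP; exists (Num.min r d) => // t.
rewrite -ball_normE /= sub0r normrN lt_min => /andP[tr td] t0.
have [|x xt E] := @mean_value_from R (fun t => g t - m / 2 * t ^+ 2) (fun t => g1 t - m * t) 0 t.
  move=> x; rewrite !subr0 => xt.
  have gx := gD x (le_lt_trans xt tr).
  apply: (is_derive_eq (is_deriveB gx (is_deriveZ (m / 2) (is_deriveX 2 (is_derive_id x 1))))).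
  by rewrite /GRing.scale /=; field.
rewrite !subr0 in xt; have := Hd x (le_lt_trans xt td).
rewrite add0r g10 subr0 => B.
have t20 : 0 < t ^+ 2 by rewrite exprn_even_gt0.
have nt (x' : R) : `|x'| * t ^+ 2 = `|x' * t ^+ 2| by rewrite normrM (gtr0_norm t20).
rewrite -(ler_pM2r t20) nt mulrBl divfK ?gt_eqF// distrC.
have -> : g t - g 0 - m / 2 * t ^+ 2 = (g1 x - m * x) * t by move: E; rewrite expr0n /=; lra.
rewrite normrM -[t ^+ 2]real_normK ?num_real// expr2 mulrA ler_wpM2r//; apply: (le_trans B).
by rewrite ler_wpM2l// ltW.
Qed.

(** If g - g 0 is a quadratic form in functions X and Y that vanish at 0 and are
    differentiable there, then the form evaluated at the slopes of X and Y gives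
    the second derivative of g, although X and Y may have no second
    derivative. *)
Lemma second_order_coefficient (g g1 X Y : R -> R) (m r l1 l2 n1 n2 n3 : R) : 0 < r ->
  (forall t : R, `|t| < r -> is_derive t 1 g (g1 t)) -> g1 0 = 0 ->
  is_derive (0 : R) 1 g1 m ->
  X 0 = 0 -> Y 0 = 0 -> is_derive (0 : R) 1 X l1 -> is_derive (0 : R) 1 Y l2 ->
  (forall t, `|t| < r -> g t - g 0 = n1 * X t ^+ 2 + n2 * (X t * Y t) + n3 * Y t ^+ 2) ->
  m = 2 * (n1 * l1 ^+ 2 + n2 * (l1 * l2) + n3 * l2 ^+ 2).
Proof.
move=> r0 gD g10 g1D X0 Y0 XD YD gE.
have slope (Z : R -> R) l : Z 0 = 0 -> is_derive (0 : R) 1 Z l -> (fun t => Z t / t) @ 0^' --> l.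
  move=> Z0 /is_derive_limit ZD; apply/cvgrPdist_le => e e0.
  have [d d0 Hd] := ZD e e0; rewrite near_withinE; apply/nbhs_ballP; exists d => // t.
  rewrite -ball_normE /= sub0r normrN => td t0.
  rewrite -(ler_pM2r (x := `|t|)) ?normr_gt0// -normrM mulrBl divfK// distrC.
  by have := Hd t td; rewrite add0r Z0 subr0.
have X' := slope _ _ X0 XD; have Y' := slope _ _ Y0 YD.
have H1 := peano2 r0 gD g10 g1D.
have H2 : (fun t : R => (g t - g 0) / t ^+ 2) @ 0^' -->
    n1 * (l1 * l1) + n2 * (l1 * l2) + n3 * (l2 * l2).
  have H3 : (fun t : R => n1 * (X t / t * (X t / t)) + n2 * (X t / t * (Y t / t)) +
      n3 * (Y t / t * (Y t / t))) @ 0^' --> n1 * (l1 * l1) + n2 * (l1 * l2) + n3 * (l2 * l2).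
    apply: cvgD; [apply: cvgD|]; apply: cvgMr; exact: cvgM.
  apply: cvg_trans H3; apply: near_eq_cvg; rewrite near_withinE.
  apply/nbhs_ballP; exists r => // t; rewrite -ball_normE /= sub0r normrN => tr t0.
  by rewrite gE//; field.
have E : m / 2 = n1 * (l1 * l1) + n2 * (l1 * l2) + n3 * (l2 * l2).
  exact: (cvg_unique _ H1 H2).
by rewrite !expr2 -E; field.
Qed.

End Inverse.

(** * Functions whose derivative is locally constant off a thin set *)
Section LineArgument.
Variable R : realType.

(** On each side of the exceptional point f is affine; differentiability of f at
    that point forces the two slopes to agree with the derivative there. *)
Lemma derivative_constant_off_point (f q : R -> R) (r : R) (Z : R -> Prop) :
  (forall t : R, `|t| < r -> is_derive t 1 f (q t)) ->
  (forall t : R, `|t| < r -> Z t \/ is_derive t 1 q 0) ->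
  (forall s t : R, `|s| < r -> `|t| < r -> Z s -> Z t -> s = t) ->
  forall s t : R, `|s| < r -> `|t| < r -> q s = q t.
Proof.
move=> fD qD Zuniq.
have between (a b x : R) : `|a| < r -> `|b| < r -> a <= x <= b -> `|x| < r.
  by rewrite !ltr_norml => /andP[? ?] /andP[? ?] /andP[? ?]; apply/andP; split; lra.
have flat (a b : R) : `|a| < r -> `|b| < r -> a < b ->
    (forall x, a <= x <= b -> ~ Z x) -> q a = q b.
  move=> ar br ab nZ; have [x xab|c _ E] := @mean_value R q (fun=> 0) a b ab.
    by case: (qD x (between _ _ _ ar br xab)) => // /(nZ x xab).
  by apply/eqP; rewrite eq_sym -subr_eq0 E mul0r.
have [[t0 [t0r Zt0]]|noZ] := pselect (exists t0 : R, `|t0| < r /\ Z t0); last first.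
  move=> s t sr tr.
  have nZ x : `|x| < r -> ~ Z x by move=> xr Zx; apply: noZ; exists x.
  have [st|ts|->//] := ltgtP s t.
  - by apply: flat => // x /(between _ _ _ sr tr)/nZ.
  - by apply/esym; apply: flat => // x /(between _ _ _ tr sr)/nZ.
suff qt0 t : `|t| < r -> q t = q t0 by move=> s t sr tr; rewrite !qt0.
move=> tr; have nZ x : `|x| < r -> x != t0 -> ~ Z x.
  by move=> xr xt0 Zx; move/eqP: xt0; apply; exact: Zuniq.
have chord : t != t0 -> forall d, 0 < d ->
    exists s, [/\ s != 0, `|s| < d & f (t0 + s) - f t0 = q t * s].
  move=> tt0 d d0; have [lt|gt|E] := ltgtP t0 t; last by rewrite E eqxx in tt0.
  - pose s := Num.min d (t - t0) / 2.
    have m0 : 0 < Num.min d (t - t0) by rewrite lt_min d0 subr_gt0.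
    have s0 : 0 < s by rewrite divr_gt0.
    have : s < Num.min d (t - t0) by rewrite /s; lra.
    rewrite lt_min => /andP[sd st]; exists s.
    rewrite gt_eqF// gtr0_norm//; split=> //.
    have [|x /andP[x1 x2]|c /andP[c1 c2] ->] := @mean_value R f q t0 (t0 + s).
    + by rewrite ltrDl.
    + by apply/fD/(between t0 t) => //; apply/andP; split; lra.
    + rewrite addrAC subrr add0r; congr (_ * _).
      have cr : `|c| < r by apply: (between t0 t) => //; apply/andP; split; lra.
      apply: flat => //; first by lra.
      move=> x /andP[x1 x2]; apply: nZ; last by rewrite gt_eqF//; lra.
      by apply: (between t0 t) => //; apply/andP; split; lra.
  - pose s := Num.min d (t0 - t) / 2.
    have m0 : 0 < Num.min d (t0 - t) by rewrite lt_min d0 subr_gt0.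
    have s0 : 0 < s by rewrite divr_gt0.
    have : s < Num.min d (t0 - t) by rewrite /s; lra.
    rewrite lt_min => /andP[sd st]; exists (- s).
    rewrite oppr_eq0 gt_eqF// normrN gtr0_norm//; split=> //.
    have [|x /andP[x1 x2]|c /andP[c1 c2] E] := @mean_value R f q (t0 - s) t0.
    + by rewrite gtrBl.
    + by apply/fD/(between t t0) => //; apply/andP; split; lra.
    + have -> : q t = q c.
        have cr : `|c| < r by apply: (between t t0) => //; apply/andP; split; lra.
        apply: flat => //; first by lra.
        move=> x /andP[x1 x2]; apply: nZ; last by rewrite lt_eqF//; lra.
        by apply: (between t t0) => //; apply/andP; split; lra.
      by move: E; lra.
have [->//|tt0] := eqVneq t t0.
apply/eqP; rewrite -subr_eq0 -normr_eq0; apply/negPn/negP => ne0.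
have e0 : 0 < `|q t - q t0| / 2 by rewrite divr_gt0// lt_neqAle eq_sym ne0/=.
have /is_derive_limit/(_ _ e0)[d d0 Hd] := fD t0 t0r.
have [s [s0 sd E]] := chord tt0 d d0.
have := Hd s sd; rewrite E -mulrBl normrM ler_pM2r ?normr_gt0//.
by move: e0; lra.
Qed.

Lemma dpart_translate v (F : R[i] -> R[i]) c y L : is_dpart v F (y + c) L ->
  is_dpart v (fun y => F (y + c)) y L.
Proof. by move=> [? ?]; split; under eq_fun do rewrite addrAC. Qed.

(** By the previous lemma D is constant on each line of direction v. So F is
    affine there, and D times v is the difference quotient of F at two points of
    the line. Move both points in the direction v 'i: the derivative of the
    quotient is a multiple of the difference of the values of D at these points,
    which is 0. *)
Lemma derivative_constant_on_square (F D : R[i] -> R[i]) (Z : R[i] -> Prop) v z (r : R) :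
  let pt (s t : R) := z + s%:C * v + t%:C * (v * 'i) in 0 < r -> v != 0 ->
  (forall s t : R, `|s| < r -> `|t| < r ->
    is_dpart v F (pt s t) (D (pt s t) * v) /\
    is_dpart (v * 'i) F (pt s t) (D (pt s t) * (v * 'i))) ->
  (forall s t : R, `|s| < r -> `|t| < r -> Z (pt s t) \/ is_dpart v D (pt s t) 0) ->
  (forall s s' t : R, `|s| < r -> `|s'| < r -> `|t| < r ->
    Z (pt s t) -> Z (pt s' t) -> s = s') ->
  forall s t : R, `|s| < r -> `|t| < r -> D (pt s t) = D z.
Proof.
move=> pt r0 v0 FD DD Zuniq.
have ptC s t : pt s t = z + t%:C * (v * 'i) + s%:C * v by rewrite /pt addrAC.
have z0 : `|0 : R| < r by rewrite normr0.
have FDs (s t : R) : `|s| < r -> `|t| < r ->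
    is_derive s 1 (fun s => complex.Re (F (pt s t))) (complex.Re (D (pt s t) * v)) /\
    is_derive s 1 (fun s => complex.Im (F (pt s t))) (complex.Im (D (pt s t) * v)).
  move=> sr tr; have [+ _] := FD s t sr tr; rewrite ptC => /dpart_line[].
  by under eq_fun do rewrite -ptC; under [X in _ -> is_derive _ _ X _ -> _]eq_fun do rewrite -ptC.
have line (s s' t : R) : `|s| < r -> `|s'| < r -> `|t| < r -> D (pt s t) = D (pt s' t).
  move=> sr s'r tr; apply: (mulIf v0).
  have ZD (x : R) : `|x| < r -> Z (pt x t) \/
      is_derive x 1 (fun s => complex.Re (D (pt s t) * v)) 0 /\
      is_derive x 1 (fun s => complex.Im (D (pt s t) * v)) 0.
    move=> xr; case: (DD x t xr tr) => [|Dx]; [by left|right].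
    have : is_dpart v (fun y => D y * v) (pt x t) 0.
      by apply: dpart_eq (dpartM Dx (dpart_cst v v _)) _; rewrite mul0r mulr0 addr0.
    rewrite ptC => /dpart_line[].
    by under eq_fun do rewrite -ptC; under [X in _ -> is_derive _ _ X _ -> _]eq_fun do rewrite -ptC.
  apply: complex_ext.
  - apply: (@derivative_constant_off_point (fun s => complex.Re (F (pt s t)))
      (fun s => complex.Re (D (pt s t) * v)) r (fun s => Z (pt s t))) => //.
    + by move=> x xr; have [] := FDs x t xr tr.
    + by move=> x /ZD[|[]]; [left|right].
    + by move=> x y xr yr; exact: Zuniq.
  - apply: (@derivative_constant_off_point (fun s => complex.Im (F (pt s t)))
      (fun s => complex.Im (D (pt s t) * v)) r (fun s => Z (pt s t))) => //.
    + by move=> x xr; have [] := FDs x t xr tr.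
    + by move=> x /ZD[|[]]; [left|right].
    + by move=> x y xr yr; exact: Zuniq.
pose s1 := r / 2.
have s10 : 0 < s1 by rewrite divr_gt0.
have s1r : `|s1| < r by rewrite gtr0_norm// /s1; lra.
have chord (t : R) : `|t| < r -> F (pt s1 t) - F (pt 0 t) = D (pt 0 t) * v * s1%:C.
  move=> tr; apply: complex_ext.
  - have [x|x xs E] := @mean_value_from R (fun s => complex.Re (F (pt s t)))
      (fun s => complex.Re (D (pt s t) * v)) 0 s1.
      by rewrite !subr0 => xs; have [] := FDs x t (le_lt_trans xs s1r) tr.
    rewrite !subr0 in xs; have xr := le_lt_trans xs s1r.
    by rewrite complexReD complexReN E (line x 0 t)// [in RHS]complexReM /= mulr0 !subr0.
  - have [x|x xs E] := @mean_value_from R (fun s => complex.Im (F (pt s t)))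
      (fun s => complex.Im (D (pt s t) * v)) 0 s1.
      by rewrite !subr0 => xs; have [] := FDs x t (le_lt_trans xs s1r) tr.
    rewrite !subr0 in xs; have xr := le_lt_trans xs s1r.
    by rewrite complexImD complexImN E (line x 0 t)// [in RHS]complexImM /= mulr0 add0r subr0.
have pt0 t : pt 0 t = z + t%:C * (v * 'i) by rewrite /pt mul0r addr0.
have vert (t : R) : `|t| < r -> D (pt 0 t) = D z.
  move=> tr; have s1C : s1%:C != 0 by rewrite (inj_eq (@complexI R)) gt_eqF.
  apply: (mulIf v0); apply: (mulIf s1C).
  have zE : z = pt 0 0 by rewrite /pt !mul0r !addr0.
  rewrite [in RHS]zE -!chord//.
  pose K y := F (y + s1%:C * v) - F y.
  have KE x : F (pt s1 x) - F (pt 0 x) = K (z + x%:C * (v * 'i)) by rewrite /K -ptC pt0.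
  rewrite !KE line0; apply: dpart0_const => x xt; have xr := le_lt_trans xt tr.
  have [_ H1] := FD s1 x s1r xr; have [_ H2] := FD 0 x z0 xr.
  rewrite ptC in H1; rewrite pt0 in H2.
  have := dpartD (dpart_translate H1) (dpartM (dpart_cst (v * 'i) (-1) _) H2).
  rewrite -ptC (line s1 0)// pt0 mul0r add0r mulN1r subrr.
  by rewrite /K; under eq_fun do rewrite mulN1r.
by move=> s t sr tr; rewrite (line s 0)// vert.
Qed.

Lemma locally_constant_connected (U : set R[i]^o) (g : R[i] -> R[i]) z0 :
  connected U -> (forall z, U z -> \forall y \near (z : R[i]^o), U y /\ g y = g z) ->
  U z0 -> forall z, U z -> g z = g z0.
Proof.
move=> conU loc Uz0.
pose E := [set z | U z /\ g z = g z0]; pose N := [set z | U z /\ g z <> g z0].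
have opE : open (E : set R[i]^o).
  rewrite openE => z [Uz gz]; rewrite /interior /=.
  by apply: filterS (loc z Uz) => y [Uy gy]; split=> //; rewrite gy.
have opN : open (N : set R[i]^o).
  rewrite openE => z [Uz gz]; rewrite /interior /=.
  by apply: filterS (loc z Uz) => y [Uy gy]; split=> //; rewrite gy.
have EU : E = U.
  apply: conU; first by exists z0.
  - by exists E => //; apply/seteqP; split=> z; [move=> [? ?]; split|move=> [_ ?]].
  - exists (~` N); first by rewrite closedC.
    apply/seteqP; split=> z.
    + by move=> [Uz gz]; split=> // -[].
    + by move=> [Uz nN]; split=> //; apply: contrapT => gz; apply: nN.
by move=> z; rewrite -{1}EU => -[].
Qed.

End LineArgument.

(** * A single slice of the solution *)
Section Slice.
Variables (R : realType) (U : set R[i]^o) (phi : R[i] -> R[i]).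
Hypotheses (openU : open U) (phi_holo : holomorphic_on U phi).
Local Notation phi' := (cderiv phi).

Lemma near_open z : U z -> \forall y \near (z : R[i]^o), U y.
Proof. by move=> Uz; apply: open_nbhs_nbhs. Qed.

Lemma wd_phi z : U z -> is_wirtinger phi z (phi' z) 0.
Proof. by move=> /phi_holo/wd_holo. Qed.

Lemma cts_phi z : U z -> cts phi z.
Proof. by move=> /phi_holo/cts_holo. Qed.

Variables (alpha delta : R) (beta gamma : R[i]) (u0 : R[i] -> R) (Q S T : R[i] -> R[i]).
Hypotheses (alpha_gt0 : 0 < alpha) (phi'_neq0 : forall z, U z -> phi' z != 0).
Hypothesis u0E : forall z, U z -> (u0 z)%:C = alpha%:C * `|phi z| ^+ 2
  + beta * phi z ^+ 2 + conjc (beta * phi z ^+ 2)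
  + gamma * phi z + conjc (gamma * phi z) + delta%:C.
Hypothesis u0_C2 : C2_on U u0 Q S T.

(** du/d(conj z) = conj phi' * dbar_factor, so the zeros of this factor are the
    critical points of the slice of u. *)
Definition dbar_factor z := alpha%:C * phi z + 2 * conjc (beta * phi z) + conjc gamma.
Local Notation G := dbar_factor.

Lemma wd_quadratic (F : R[i] -> R[i]) (a b c d : R[i]) z p : conjc a = a -> conjc d = d ->
  is_wirtinger F z p 0 ->
  is_wirtinger (fun y => a * (F y * conjc (F y)) + b * (F y * F y) + conjc (b * (F y * F y))
    + c * F y + conjc (c * F y) + d) z
    (p * (a * conjc (F z) + 2 * b * F z + c))
    (conjc p * (a * F z + 2 * conjc (b * F z) + conjc c)).
Proof.
move=> ar dr Fp.
have FF := wdZ b (wdM Fp Fp).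
have := wdD (wdD (wdD (wdD (wdD (wdZ a (wdM Fp (wd_conj Fp))) FF) (wd_conj FF))
  (wdZ c Fp)) (wd_conj (wdZ c Fp))) (wd_cst d z).
move/wd_eq; apply; rewrite !(conjcM, conjcD, conjc0); ring.
Qed.

Lemma dbar_u0 z : U z -> Q z = conjc (phi' z) * G z.
Proof.
move=> Uz; have [[H _ _ _ _] _] := u0_C2 Uz.
have := wd_quadratic beta gamma (conjc_real alpha) (conjc_real delta) (wd_phi Uz).
move/wd_near => /(_ (fun y => (u0 y)%:C)) H'.
have {}H' := H' _; apply: (proj2 (wd_unique H (H' _))).
apply: filterS (near_open Uz) => y Uy.
by rewrite u0E// sqr_normc !expr2.
Qed.

Lemma wd_dbar_factor z : U z -> is_wirtinger G z (alpha%:C * phi' z) (2 * conjc (beta * phi' z)).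
Proof.
move=> Uz; have F := wd_phi Uz.
have := wdD (wdD (wdZ alpha%:C F) (wdZ 2 (wd_conj (wdZ beta F)))) (wd_cst (conjc gamma) z).
by move/wd_eq; apply; rewrite ?mulr0 ?conjc0; ring.
Qed.

Lemma cts_dbar_factor z : U z -> cts G z.
Proof.
move=> Uz; have F := cts_phi Uz.
exact: ctsD (ctsD (ctsZ F) (ctsZ (cts_conj (ctsZ F)))) (cts_cst (conjc gamma) z).
Qed.

Definition regular_set := [set z | U z /\ G z != 0].

Lemma near_regular z : regular_set z -> \forall y \near (z : R[i]^o), regular_set y.
Proof.
move=> [Uz Gz].
have N : \forall y \near (z : R[i]^o), G y != 0.
  have nz : nbhs (G z : R[i]^o) [set x | x != 0].
    apply/nbhs_ballP; exists `|G z|; rewrite /= ?normr_gt0// => x.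
    by rewrite -ball_normE /=; apply: contraTneq => ->; rewrite subr0 ltxx.
  exact: (cts_dbar_factor Uz nz).
by apply: filterS2 N (near_open Uz) => y Gy Uy.
Qed.

Lemma phi'E z : regular_set z -> phi' z = conjc (Q z) * (conjc (G z))^-1.
Proof.
by move=> [Uz Gz]; rewrite dbar_u0// conjcM conjcK mulfK// conjc_eq0.
Qed.

Lemma near_phi'E z : regular_set z -> \forall y \near (z : R[i]^o),
  conjc (Q y) * (conjc (G y))^-1 = phi' y.
Proof. by move=> /near_regular; apply: filterS => y Wy; rewrite phi'E. Qed.

Lemma cts_phi' z : regular_set z -> cts phi' z.
Proof.
move=> Wz; have [Uz Gz] := Wz; have [[_ _ Qc _ _] _] := u0_C2 Uz.
apply: cts_near (near_phi'E Wz) _.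
apply: ctsM (cts_conj Qc) (ctsV _ (cts_conj (cts_dbar_factor Uz))).
by rewrite conjc_eq0.
Qed.

(** Off the critical points phi' = conj (du/d(conj z) / dbar_factor) is as smooth
    as the first derivatives of u; then it is holomorphic, and differentiating
    conj phi' * dbar_factor gives the Laplacian. *)
Lemma phi'_holo z : regular_set z ->
  exists2 p : R[i] -> R[i], forall y, regular_set y -> is_wirtinger phi' y (p y) 0 /\ cts p y
  & S z = alpha%:C * (phi' z * conjc (phi' z)).
Proof.
pose iG y := (conjc (G y))^-1.
pose dG y := conjc (Q y) * - (conjc (G y)) ^- 2.
pose p y := conjc (T y) * iG y + dG y * (2 * beta * phi' y).
pose q y := conjc (S y) * iG y + dG y * (alpha%:C * conjc (phi' y)).
have W y : regular_set y -> [/\ is_wirtinger phi' y (p y) (q y), cts p y & cts q y].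
  move=> Wy; have [Uy Gy] := Wy; have [[_ Qd Qc Sc Tc] _] := u0_C2 Uy.
  have Gy' : conjc (G y) != 0 by rewrite conjc_eq0.
  have iGc : cts iG y := @ctsV R (fun x => conjc (G x)) y Gy' (cts_conj (cts_dbar_factor Uy)).
  have dGc : cts dG y.
    have := ctsM (cts_conj Qc) (ctsN (ctsM iGc iGc)); apply: cts_near.
    by apply/nbhs_square; exists 1 => // x _ _; rewrite /dG /iG expr2 invfM.
  have pc := cts_phi' Wy.
  split.
  - apply: wd_near (near_phi'E Wy) _.
    have := wdM (wd_conj Qd) (@wdV R (fun x => conjc (G x)) y _ _ Gy' (wd_conj (wd_dbar_factor Uy))).
    by move/wd_eq; apply; rewrite /p /q /dG /iG !(conjcM, conjcK, conjc_nat, conjc_real); ring.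
  - exact: ctsD (ctsM (cts_conj Tc) iGc) (ctsM dGc (ctsZ pc)).
  - exact: ctsD (ctsM (cts_conj Sc) iGc) (ctsM dGc (ctsZ (cts_conj pc))).
have q0 y : regular_set y -> q y = 0.
  move=> Wy; have [_ pc qc] := W y Wy.
  apply: (@holo_derivative_holo R phi phi' p q y _ pc qc).
  apply: filterS (near_regular Wy) => x Wx; have [? _ _] := W x Wx.
  by split=> //; apply: wd_phi; case: Wx.
move=> Wz; exists p => [y Wy|].
  by have [D pc _] := W y Wy; split=> //; move: D; rewrite q0.
have [Uz Gz] := Wz; have [_ Sr] := u0_C2 Uz.
have Gz' : conjc (G z) != 0 by rewrite conjc_eq0.
have := q0 z Wz; rewrite /q /dG /iG Sr (dbar_u0 Uz) conjcM conjcK => E.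
have : S z - alpha%:C * (phi' z * conjc (phi' z)) = 0.
  by rewrite -[RHS](mul0r (conjc (G z))) -E; field.
by move/eqP; rewrite subr_eq0 => /eqP.
Qed.

(** At a critical point the terms of u that are linear in phi - phi z cancel. *)
Lemma critical_expansion z y : U z -> U y -> G z = 0 ->
  let X := complex.Re (phi y - phi z) in let Y := complex.Im (phi y - phi z) in
  u0 y - u0 z = (alpha + 2 * complex.Re beta) * X ^+ 2 + (- 4 * complex.Im beta) * (X * Y)
    + (alpha - 2 * complex.Re beta) * Y ^+ 2.
Proof.
move=> Uz Uy Gz /=.
have re x : U x -> u0 x = alpha * (complex.Re (phi x) ^+ 2 + complex.Im (phi x) ^+ 2)
    + 2 * (complex.Re beta * (complex.Re (phi x) ^+ 2 - complex.Im (phi x) ^+ 2)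
      - 2 * complex.Im beta * (complex.Re (phi x) * complex.Im (phi x)))
    + 2 * (complex.Re gamma * complex.Re (phi x) - complex.Im gamma * complex.Im (phi x))
    + delta.
  move=> Ux; have := congr1 (@complex.Re R) (u0E Ux).
  rewrite sqr_normc !expr2 !(complexReD, complexReM, complexImM, complexReJ, complexImJ) /= => ->.
  ring.
have := congr1 (@complex.Re R) Gz; have := congr1 (@complex.Im R) Gz.
rewrite /dbar_factor !(complexReD, complexReM, complexReJ, complexImD, complexImM, complexImJ) /=.
rewrite !(complexReN, complexImN, re) //.
move: (phi y) (phi z) => [a b] [a0 b0] /= G2 G1.
have -> : complex.Re gamma = - (alpha * a0 + 2 * (complex.Re beta * a0 - complex.Im beta * b0)) by lra.
have -> : complex.Im gamma = alpha * b0 - 2 * (complex.Re beta * b0 + complex.Im beta * a0) by lra.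
ring.
Qed.

Lemma critical_second_variation v z K M : U z -> G z = 0 ->
  (forall y, U y -> is_dpart v (fun y => (u0 y)%:C) y (K y)) -> K z = 0 -> is_dpart v K z M ->
  let l := phi' z * v in
  complex.Re M = 2 * ((alpha + 2 * complex.Re beta) * complex.Re l ^+ 2
    + (- 4 * complex.Im beta) * (complex.Re l * complex.Im l)
    + (alpha - 2 * complex.Re beta) * complex.Im l ^+ 2).
Proof.
move=> Uz Gz uK Kz KM /=.
have [r r0 Hr] := near_on_line v (near_open Uz).
have psiD : is_dpart v (fun y => phi y - phi z) z (phi' z * v).
  apply: dpart_eq (dpartD (dpart_holo v (phi_holo Uz)) (dpart_cst v (- phi z) z)) _.
  by rewrite addr0.
apply: (@second_order_coefficient R (fun t : R => u0 (z + t%:C * v))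
  (fun t : R => complex.Re (K (z + t%:C * v)))
  (fun t : R => complex.Re (phi (z + t%:C * v) - phi z))
  (fun t : R => complex.Im (phi (z + t%:C * v) - phi z)) _ r) => //.
- by move=> t tr; have /dpart_line[] := uK _ (Hr t tr).
- by rewrite line0 Kz.
- by case: KM.
- by rewrite line0 subrr.
- by rewrite line0 subrr.
- by case: psiD.
- by case: psiD.
- by move=> t tr; rewrite line0; apply: critical_expansion => //; exact: Hr.
Qed.

(** At a critical point no differentiability of phi' is available; but u is a
    quadratic form in phi - phi z, which determines its second derivatives
    along 1 and 'i, and the contributions of beta cancel in their sum. *)
Lemma critical_laplacian z : U z -> G z = 0 ->
  S z = alpha%:C * (phi' z * conjc (phi' z)).
Proof.
move=> Uz Gz; have [[_ [Qx Qy] _ _ _] Sr] := u0_C2 Uz.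
have Qz : Q z = 0 by rewrite dbar_u0// Gz mulr0.
have u1 y : U y -> is_dpart 1 (fun y => (u0 y)%:C) y (conjc (Q y) + Q y).
  by move=> /u0_C2[[[]]].
have ui y : U y -> is_dpart 'i (fun y => (u0 y)%:C) y ('i * (conjc (Q y) + -1 * Q y)).
  by move=> /u0_C2[[[_ ?]]]; rewrite mulN1r.
have E1 := critical_second_variation Uz Gz u1 _ (dpartD (dpart_conj Qx) Qx).
have Ei := critical_second_variation Uz Gz ui _
  (dpartM (dpart_cst 'i 'i z) (dpartD (dpart_conj Qy) (dpartM (dpart_cst 'i (-1) z) Qy))).
move: E1 Ei; rewrite Qz conjc0 mulr0 addr0 mulr0 => /(_ erefl) + /(_ erefl).
rewrite mulr1 !(complexReD, complexImD, complexReM, complexImM, complexReJ, complexImJ,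
  complexReN, complexImN).
have : complex.Im (S z) = 0 by move: Sr; case: (S z) => s1 s2 [] /= /eqP; lra.
move: (S z) (T z) (phi' z) => [s1 s2] [t1 t2] [l1 l2] /= s20 E1 Ei.
apply: complex_ext; rewrite /= ?s20; last by ring.
lra.
Qed.

Lemma laplacian_u0 z : U z -> S z = alpha%:C * (phi' z * conjc (phi' z)).
Proof.
move=> Uz; have [Gz|Gz] := eqVneq (G z) 0; first exact: critical_laplacian.
by have [] := @phi'_holo z (conj Uz Gz).
Qed.

(** From here on C is a constant for which D, the derivative of
    F = phi + C phi^2 / 2, is locally constant off the critical points. *)
Variable C : R[i].
Let D y := phi' y * (1 + C * phi y).
Let F y := phi y + 2^-1 * C * (phi y * phi y).
Hypothesis D_regular : forall y, regular_set y -> is_wirtinger D y 0 0.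

Let dpart_F v y : U y -> is_dpart v F y (D y * v).
Proof.
move=> /phi_holo/(dpart_holo v) P.
apply: dpart_eq (dpartD P (dpartM (dpart_cst v (2^-1 * C) y) (dpartM P P))) _.
by rewrite /D mul0r add0r; field.
Qed.

Lemma cts_id (z : R[i]) : cts (fun y => y) z.
Proof. by move=> A. Qed.

(** The condition on L says that the second derivative of u along v is positive
    at z. Then u is strictly convex on each nearby line of direction v, so such
    a line carries at most one critical point, and [derivative_constant_on_square]
    makes D constant near z. *)
Lemma constant_near_critical v L z : U z -> v * conjc v = 1 ->
  (forall y, U y -> is_dpart v Q y (L y)) -> (forall y, regular_set y -> is_dpart v D y 0) ->
  cts L z -> 0 < complex.Re (L z * conjc v) ->
  \forall y \near (z : R[i]^o), U y /\ D y = D z.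
Proof.
move=> Uz vv QL Dreg Lc Lz.
have v0 : v != 0 by apply: contra_eq_neq vv => ->; rewrite mul0r eq_sym oner_neq0.
have Lpos : \forall y \near (z : R[i]^o), 0 < complex.Re (L y * conjc v).
  have /cts_square/(_ _ Lz)[r r0 Hr] : cts (fun y => L y * conjc v) z.
    exact: ctsM Lc (cts_cst (conjc v) z).
  apply/nbhs_square; exists r => // y yr yi; have [H _] := Hr y yr yi.
  by move: H; rewrite ltr_norml => /andP[]; lra.
have near_z : nbhs (z + 0 * v : R[i]^o) [set y | U y /\ 0 < complex.Re (L y * conjc v)].
  by rewrite mul0r addr0; apply: filterS2 Lpos (near_open Uz) => y.
have affine : cts (fun x => z + x * v) 0.
  exact: ctsD (cts_cst z 0) (ctsM (cts_id (z := 0)) (cts_cst v 0)).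
have /nbhs_square[r r0 Hr] := affine _ near_z.
pose pt (s t : R) := z + s%:C * v + t%:C * (v * 'i).
have ptE s t : pt s t = z + (s%:C + t%:C * 'i) * v by rewrite /pt; ring.
have Hpt (s t : R) : `|s| < r -> `|t| < r ->
    U (pt s t) /\ 0 < complex.Re (L (pt s t) * conjc v).
  move=> sr tr; rewrite ptE; apply: Hr.
  - by rewrite complexReD complexReM /= mulr0 mul0r !subr0 addr0.
  - by rewrite complexImD complexImM /= mulr1 mul0r addr0 add0r subr0.
have const : forall s t : R, `|s| < r -> `|t| < r -> D (pt s t) = D z.
  apply: (@derivative_constant_on_square R F D (fun y => G y = 0)) => //.
  - by move=> s t sr tr; have [Up _] := Hpt s t sr tr; split; exact: dpart_F.
  - move=> s t sr tr; have [Up _] := Hpt s t sr tr.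
    by have [|Gp] := eqVneq (G (pt s t)) 0; [left|right; apply: Dreg].
  (* Two critical points on a line would be two zeros of a strictly increasing
     function, the derivative of u along v. *)
  - suff incr (s s' t : R) : `|s| < r -> `|s'| < r -> `|t| < r -> s < s' ->
        G (pt s t) = 0 -> G (pt s' t) = 0 -> False.
      move=> s s' t sr s'r tr Gs Gs'; have [ss'|s's|//] := ltgtP s s'.
      + by case: (incr s s' t).
      + by case: (incr s' s t).
    move=> sr s'r tr ss' Gs Gs'.
    have [x /andP[sx xs']|x /andP[sx xs'] E] := @mean_value R
        (fun x : R => complex.Re (Q (pt x t) * conjc v))
        (fun x : R => complex.Re (L (pt x t) * conjc v)) s s' ss'.
      have xr : `|x| < r by move: sr s'r; rewrite !ltr_norml => /andP[? ?] /andP[? ?];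
        apply/andP; split; lra.
      have [Up _] := Hpt x t xr tr.
      have : is_dpart v (fun y => Q y * conjc v) (pt x t) (L (pt x t) * conjc v).
        apply: dpart_eq (dpartM (QL _ Up) (dpart_cst v (conjc v) _)) _.
        by rewrite mulr0 addr0.
      rewrite /pt addrAC => /dpart_line[+ _]; congr is_derive.
      + by apply/funext => y; rewrite addrAC.
    have xr : `|x| < r by move: sr s'r; rewrite !ltr_norml => /andP[? ?] /andP[? ?];
        apply/andP; split; lra.
    have [_ Lx] := Hpt x t xr tr.
    have [Us _] := Hpt s t sr tr; have [Us' _] := Hpt s' t s'r tr.
    have Qs : Q (pt s t) = 0 by rewrite dbar_u0 ?Gs ?mulr0.
    have Qs' : Q (pt s' t) = 0 by rewrite dbar_u0 ?Gs' ?mulr0.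
    move: E; rewrite Qs Qs' mul0r subrr => /esym/eqP.
    by rewrite mulf_eq0 (gt_eqF Lx) gt_eqF ?subr_gt0.
(* Coordinates of a point y near z in the frame v, v 'i. *)
have back : cts (fun y => conjc v * (y - z)) z.
  exact: ctsZ (ctsD (cts_id (z := z)) (cts_cst (- z) z)).
have near0 : nbhs (conjc v * (z - z) : R[i]^o) [set x | `|complex.Re x| < r /\ `|complex.Im x| < r].
  by rewrite subrr mulr0; apply/nbhs_square; exists r => // y; rewrite /= !subr0.
apply: filterS2 (near_open Uz) (back _ near0) => y Uy [/= yr yi]; split=> //.
rewrite -(const _ _ yr yi); congr D; rewrite ptE.
set x := conjc v * _; have -> : (complex.Re x)%:C + (complex.Im x)%:C * 'i = x.
  by rewrite [RHS]complexE [in RHS]mulrC.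
by rewrite /x mulrAC [conjc v * v]mulrC vv mul1r addrC subrK.
Qed.

(** At a critical point the second derivatives of u along 1 and 'i have a
    positive sum, hence one of the two is positive. *)
Lemma derivative_locally_constant z : U z ->
  \forall y \near (z : R[i]^o), U y /\ D y = D z.
Proof.
move=> Uz; have [Gz|Gz] := eqVneq (G z) 0; last first.
  have /nbhs_square[r r0 Hr] := near_regular (conj Uz Gz).
  apply/nbhs_square; exists r => // y yr yi; split; first by case: (Hr y yr yi).
  by apply: (wd0_const (r := r)) => // x xr xi; apply/D_regular/Hr.
have [[_ _ _ Sc Tc] _] := u0_C2 Uz.
have Spos : 0 < complex.Re (S z).
  rewrite laplacian_u0// -sqr_normc -add_Re2_Im2 /= mulr0 subr0 mulr_gt0//.
  have := phi'_neq0 Uz; rewrite eq_complex /= negb_and => /orP[n0|n0].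
  - by rewrite ltr_pwDl ?sqr_ge0// exprn_even_gt0.
  - by rewrite ltr_wpDl ?sqr_ge0// exprn_even_gt0.
have [pos|neg] := ltP 0 (complex.Re (S z + T z)).
- apply: (@constant_near_critical 1 (fun y => S y + T y) z Uz).
  + by rewrite conjc1 mulr1.
  + by move=> y /u0_C2[[_ []]].
  + by move=> y /D_regular[+ _]; rewrite addr0.
  + exact: ctsD.
  + by rewrite conjc1 mulr1.
- apply: (@constant_near_critical 'i (fun y => 'i * (S y - T y)) z Uz).
  + by rewrite conjc_i mulrN -expr2 sqr_i opprK.
  + by move=> y /u0_C2[[_ []]].
  + by move=> y /D_regular[_]; rewrite subr0 mulr0.
  + exact: ctsZ (ctsB Sc Tc).
  + rewrite conjc_i mulrN mulrAC -expr2 sqr_i mulN1r opprK.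
    by move: neg; rewrite !complexReD complexReN; lra.
Qed.

Hypotheses (conU : connected U) (U0 : U 0) (phi0 : phi 0 = 0) (phi'0 : phi' 0 = 1).

Lemma quadratic_identity z : U z -> phi z + 2^-1 * C * (phi z * phi z) = z.
Proof.
have D1 y : U y -> D y = 1.
  move=> Uy; rewrite (locally_constant_connected conU derivative_locally_constant U0 Uy).
  by rewrite /D phi0 phi'0 mulr0 addr0 mulr1.
have E0 y : U y -> is_wirtinger (fun y => F y - y) y 0 0.
  move=> Uy; have P v := dpartD (dpart_F v Uy)
    (dpartM (dpart_cst v (-1) y) (dpart_holo v (f := id) (@derivable_id _ _ (y : R[i]^o) 1))).
  have cid : cderiv id y = 1 by rewrite /cderiv derive_id.
  split.
  - have := P 1; rewrite cid D1// !mulr1 mul0r add0r subrr addr0.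
    by under eq_fun do rewrite mulN1r.
  - have := P 'i; rewrite cid D1// !mul1r mul0r add0r mulN1r !subrr mulr0.
    by under eq_fun do rewrite mulN1r.
have loc y : U y -> \forall x \near (y : R[i]^o), U x /\ F x - x = F y - y.
  move=> /near_open/nbhs_square[r r0 Hr].
  apply/nbhs_square; exists r => // x xr xi; split; first exact: Hr.
  by apply: (wd0_const (F := fun y => F y - y) (r := r)) => // t tr ti; apply/E0/Hr.
move=> Uz; have := locally_constant_connected conU loc U0 Uz.
by rewrite [in RHS]/F phi0 !mulr0 addr0 subrr => /eqP; rewrite subr_eq0 => /eqP.
Qed.

End Slice.

(** * The polarized Monge-Ampere equation *)
Section Polarization.
Variables (R : realType) (W : set R[i]^o) (phi phi' p : R[i] -> R[i]).
Variables (A B B' C C' : R[i]).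
Hypothesis openW : forall z, W z -> \forall y \near (z : R[i]^o), W y.
Hypothesis phiP : forall z, W z ->
  [/\ is_wirtinger phi z (phi' z) 0, is_wirtinger phi' z (p z) 0, cts phi z, cts phi' z & cts p z].
Hypothesis phi'_neq0 : forall z, W z -> phi' z != 0.
Hypothesis modulusE : forall z, W z -> phi' z * conjc (phi' z) *
  (A * (phi z * conjc (phi z)) + B * (phi z * phi z) + B' * conjc (phi z * phi z)
   + C * phi z + C' * conjc (phi z) + 1) = 1.

Lemma wd_identity F G z a b a' b' : W z -> (forall y, W y -> F y = G y) ->
  is_wirtinger F z a b -> is_wirtinger G z a' b' -> a = a' /\ b = b'.
Proof.
move=> Wz FG HF HG; apply: wd_unique HG; apply: wd_near HF.
by apply: filterS (openW Wz) => y; exact: FG.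
Qed.

Local Notation cphi y := (conjc (phi y)).
Let f y := (phi' y)^-1.
Let f1 y := - (phi' y) ^- 2 * p y.
Let h y := f1 y * f y.

Let cphi'_neq0 z : W z -> conjc (phi' z) != 0.
Proof. by move=> /phi'_neq0; rewrite conjc_eq0. Qed.

Let f_neq0 z : W z -> f z != 0.
Proof. by move=> /phi'_neq0; rewrite invr_eq0. Qed.

Let cf_neq0 z : W z -> conjc (f z) != 0.
Proof. by move=> /f_neq0; rewrite conjc_eq0. Qed.

Let wd_f z : W z -> is_wirtinger f z (f1 z) 0.
Proof.
move=> Wz; have [_ P _ _ _] := phiP Wz.
by apply: wd_eq (wdV (phi'_neq0 Wz) P) _ _; rewrite // mulr0.
Qed.

Let cts_f z : W z -> cts f z.
Proof. by move=> Wz; have [_ _ _ P _] := phiP Wz; exact: ctsV (phi'_neq0 Wz) P. Qed.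

Let f1E z : W z -> f1 z = h z * phi' z.
Proof. by move=> Wz; rewrite /h /f -mulrA mulVf ?mulr1// phi'_neq0. Qed.

Let cts_f1 z : W z -> cts f1 z.
Proof.
move=> Wz; have [_ _ _ P Q] := phiP Wz; have F := cts_f Wz.
have := ctsM (ctsN (ctsM F F)) Q; apply: cts_near.
by apply/nbhs_square; exists 1 => // y _ _; rewrite /f1 /f expr2 invfM.
Qed.

Let cts_h z : W z -> cts h z.
Proof. by move=> Wz; exact: ctsM (cts_f1 Wz) (cts_f Wz). Qed.

Let modulus_f z : W z -> f z * conjc (f z) = A * (phi z * cphi z) + B * (phi z * phi z)
  + B' * conjc (phi z * phi z) + C * phi z + C' * cphi z + 1.
Proof.
move=> Wz; have N : phi' z * conjc (phi' z) != 0.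
  by rewrite mulf_neq0 ?phi'_neq0 ?cphi'_neq0.
by apply: (mulfI N); rewrite modulusE// /f conjc_inv; field; rewrite phi'_neq0 ?cphi'_neq0.
Qed.

(** [modulus_f] differentiated with respect to z and to conj z, then divided by
    phi' and conj phi'. *)
Let first_order z : W z -> h z * conjc (f z) = A * cphi z + 2 * B * phi z + C /\
  f z * conjc (h z) = A * phi z + 2 * B' * cphi z + C'.
Proof.
move=> Wz; have [P _ _ _ _] := phiP Wz; have F := wd_f Wz; have PP := wdM P P.
have := wdD (wdD (wdD (wdD (wdD (wdZ A (wdM P (wd_conj P))) (wdZ B PP))
  (wdZ B' (wd_conj PP))) (wdZ C P)) (wdZ C' (wd_conj P))) (wd_cst 1 z).
move=> /(wd_identity Wz modulus_f (wdM F (wd_conj F)))[E1 E2]; split.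
- apply: (mulIf (phi'_neq0 Wz)); move: E1; rewrite f1E// !(conjc0, conjcM, conjcD) => E1.
  transitivity (h z * phi' z * conjc (f z) + f z * 0); first by ring.
  by rewrite E1; ring.
- apply: (mulIf (cphi'_neq0 Wz)); move: E2; rewrite f1E// (conjcM (h z)) conjcD.
  rewrite (conjcM (phi' z)) (conjcM (phi z)) => E2.
  transitivity (0 * conjc (f z) + f z * (conjc (h z) * conjc (phi' z))); first by ring.
  by rewrite E2; ring.
Qed.

Let k z := 2 * B * phi' z * (conjc (f z))^-1.

(** By the first identity above, h is a smooth expression in phi, f and f1, so
    f1 = h * phi' has continuous partial derivatives and [holo_derivative_holo]
    applies to f. *)
Let wd_h z : W z -> is_wirtinger h z (k z) 0.
Proof.
pose icf y := (conjc (f y))^-1.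
pose N y := A * cphi y + 2 * B * phi y + C.
pose l y := A * conjc (phi' y) * icf y + N y * (- (icf y * icf y) * conjc (f1 y)).
have D y : W y -> [/\ is_wirtinger h y (k y) (l y), cts k y & cts l y].
  move=> Wy; have [P _ Pc P'c _] := phiP Wy.
  have icfc : cts icf y := @ctsV R (fun x => conjc (f x)) y (cf_neq0 Wy) (cts_conj (cts_f Wy)).
  split.
  - have H : is_wirtinger (fun y => N y * icf y) y (k y) (l y).
      have := wdM (wdD (wdD (wdZ A (wd_conj P)) (wdZ (2 * B) P)) (wd_cst C y))
        (@wdV R (fun x => conjc (f x)) y _ _ (cf_neq0 Wy) (wd_conj (wd_f Wy))).
      move/wd_eq; apply; rewrite /k /l /N /icf ?conjc0 ?expr2 ?invfM; ring.
    apply: wd_near H; apply: filterS (openW Wy) => x Wx.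
    by have [E _] := first_order Wx; rewrite /N -E /icf mulfK// cf_neq0.
  - exact: ctsM (ctsZ P'c) icfc.
  - have Nc : cts N y := ctsD (ctsD (ctsZ (cts_conj Pc)) (ctsZ Pc)) (cts_cst C y).
    exact: ctsD (ctsM (ctsZ (cts_conj P'c)) icfc)
      (ctsM Nc (ctsM (ctsN (ctsM icfc icfc)) (cts_conj (cts_f1 Wy)))).
suff l0 y : W y -> l y = 0.
  by move=> Wz; have [+ _ _] := D z Wz; rewrite l0.
move=> Wy; have : l y * phi' y = 0.
  apply: (@holo_derivative_holo R f f1 (fun y => k y * phi' y + h y * p y)
    (fun y => l y * phi' y)).
  - apply: filterS (openW Wy) => x Wx; split; first exact: wd_f.
    have [Hx _ _] := D x Wx; have [_ P' _ _ _] := phiP Wx.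
    have := wdM Hx P'; rewrite mulr0 addr0; apply: wd_near.
    by apply: filterS (openW Wx) => t Wt; rewrite f1E.
  - have [_ kc _] := D y Wy; have [_ _ _ P'c pc] := phiP Wy.
    exact: ctsD (ctsM kc P'c) (ctsM (cts_h Wy) pc).
  - have [_ _ lc] := D y Wy; have [_ _ _ P'c _] := phiP Wy.
    exact: ctsM lc P'c.
by move/eqP; rewrite mulf_eq0 (negPf (phi'_neq0 Wy)) orbF => /eqP.
Qed.

(** The derivative with respect to conj z of the first identity in
    [first_order]. *)
Let modulus_h z : W z -> h z * conjc (h z) = A.
Proof.
move=> Wz; have [P _ _ _ _] := phiP Wz.
have := wdD (wdD (wdZ A (wd_conj P)) (wdZ (2 * B) P)) (wd_cst C z).
move=> /(wd_identity Wz (fun y Wy => proj1 (first_order Wy))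
  (wdM (wd_h Wz) (wd_conj (wd_f Wz))))[_ E].
apply: (mulIf (cphi'_neq0 Wz)); move: E; rewrite f1E// (conjcM (h z) (phi' z)) => E.
transitivity (0 * conjc (f z) + h z * (conjc (h z) * conjc (phi' z))); first by ring.
  by rewrite E; ring.
Qed.

(** A holomorphic function of constant modulus is constant: where h does not
    vanish, differentiate h * conj h = A; otherwise A = 0 and h vanishes
    identically. *)
Let k_eq0 z : W z -> k z = 0.
Proof.
move=> Wz; have H := wd_h Wz.
have [hz|hz] := eqVneq (h z) 0.
  have A0 : A = 0 by rewrite -(modulus_h Wz) hz mul0r.
  have h0 y : W y -> h y = 0.
    move=> Wy; have /eqP := modulus_h Wy.
    by rewrite A0 mulf_eq0 conjc_eq0 orbb => /eqP.
  by have [] := wd_identity Wz h0 H (wd_cst 0 z).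
have [E _] := wd_identity Wz modulus_h (wdM H (wd_conj H)) (wd_cst A z).
move: E; rewrite conjc0 mulr0 addr0 => /eqP.
by rewrite mulf_eq0 conjc_eq0 (negPf hz) orbF => /eqP.
Qed.

Let e z := f z - phi z * h z.

(** h being constant, f = e + h phi with e constant; comparing coefficients in
    f * conj f, whose constant term is 1, gives |e| = 1 and conj e * h = C. *)
Let linear_coefficients z : W z ->
  [/\ conjc (e z) * e z = 1, conjc (e z) * h z = C & is_wirtinger e z 0 0].
Proof.
move=> Wz; have two : (2 : R[i]) != 0 by rewrite pnatr_eq0.
have B0 : B = 0.
  have /eqP := k_eq0 Wz; rewrite /k !mulf_eq0 invr_eq0 (negPf two) (negPf (phi'_neq0 Wz)).
  by rewrite (negPf (cf_neq0 Wz)) !orbF => /eqP.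
have H y : W y -> is_wirtinger h y 0 0 by move=> Wy; have := wd_h Wy; rewrite k_eq0.
have [P _ _ _ _] := phiP Wz.
have B'0 : B' = 0.
  have := wdD (wdD (wdZ A P) (wdZ (2 * B') (wd_conj P))) (wd_cst C' z).
  move=> /(wd_identity Wz (fun y Wy => proj2 (first_order Wy))
    (wdM (wd_f Wz) (wd_conj (H z Wz))))[_ /eqP].
  rewrite !(conjc0, mul0r, mulr0, add0r, addr0) eq_sym !mulf_eq0 (negPf two).
  by rewrite (negPf (cphi'_neq0 Wz)) orbF => /eqP.
have eD : is_wirtinger e z 0 0.
  apply: wd_eq (wdB (wd_f Wz) (wdM P (H z Wz))) _ _; last by ring.
  by rewrite f1E//; ring.
have feE y : W y -> conjc (f y) * e y = C' * cphi y + 1.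
  move=> Wy; rewrite /e mulrBr mulrCA [conjc (f y) * h y]mulrC.
  have [-> _] := first_order Wy.
  by rewrite mulrC modulus_f// B0 B'0; ring.
have heE : conjc (h z) * e z = C'.
  have := wdD (wdZ C' (wd_conj P)) (wd_cst 1 z).
  move=> /(wd_identity Wz feE (wdM (wd_conj (wd_f Wz)) eD))[_ E].
  apply: (mulIf (cphi'_neq0 Wz)); move: E; rewrite f1E// (conjcM (h z) (phi' z)) => E.
  transitivity (conjc (h z) * conjc (phi' z) * e z + conjc (f z) * 0); first by ring.
  by rewrite E; ring.
have ceE : conjc (e z) = conjc (f z) - cphi z * conjc (h z).
  by rewrite /e conjcB conjcM.
split=> //.
- rewrite ceE mulrBl feE// -mulrA heE; ring.
- rewrite ceE mulrBl -mulrA [conjc (h z) * _]mulrC modulus_h// mulrC.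
  by have [-> _] := first_order Wz; rewrite B0; ring.
Qed.

(** Since f = e + h phi = e (1 + C phi), this function is conj e. *)
Lemma primitive_derivative_locally_constant z : W z ->
  is_wirtinger (fun y => phi' y * (1 + C * phi y)) z 0 0.
Proof.
move=> Wz; have [_ _ /wd_conj] := linear_coefficients Wz.
rewrite conjc0; apply: wd_near; apply: filterS (openW Wz) => y Wy.
have [E1 E2 _] := linear_coefficients Wy.
rewrite -E2 -[X in X + _]E1 -mulrA -mulrDr (_ : e y + h y * phi y = f y); last first.
  by rewrite /e mulrC; ring.
by rewrite mulrCA /f mulfV ?mulr1// phi'_neq0.
Qed.

End Polarization.

(** * The square root branch *)
Section SquareRoot.
Variable R : realType.
Implicit Types (x y z alpha : R[i]).

Lemma Re_sqrtc_ge0 x : 0 <= complex.Re (sqrtc x).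
Proof. by case: x => a b; exact: sqrtr_ge0. Qed.

Lemma Re_neq0_of_sqr x : 0 < complex.Re (x ^+ 2) -> complex.Re x != 0.
Proof.
move=> H; apply/eqP => x0; move: H; rewrite expr2 complexReM x0 mul0r sub0r.
by rewrite oppr_gt0 -expr2 ltNge sqr_ge0.
Qed.

Lemma sqrtc_unique x y : 0 < complex.Re x -> y = x ^+ 2 -> sqrtc y = x.
Proof.
move=> x0 yE; have /eqP := sqr_sqrtc y; rewrite [X in _ == X]yE eqf_sqr.
case/orP => /eqP// E; have := Re_sqrtc_ge0 y.
by rewrite E complexReN oppr_ge0 leNgt x0.
Qed.

Lemma Re_disc_gt0 alpha z : alpha != 0 -> disc (1 / (2 * complex.Re `|alpha|)) z ->
  0 < complex.Re (1 - 2 * alpha * z).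
Proof.
rewrite /disc /= => a0.
have n0 : 0 < complex.Re `|alpha| by move: a0; rewrite -normr_gt0 ltcE => /andP[].
rewrite ltr_pdivlMr ?mulr_gt0// => zr.
have : `|complex.Re (2 * alpha * z)| < 1.
  apply: le_lt_trans zr; rewrite -lecR; apply: le_trans (normc_ge_Re _) _.
  have nE (x : R[i]) : (complex.Re `|x|)%:C = `|x| by rewrite RRe_real ?normr_real.
  have E (x y : R) : (x * (2 * y))%:C = x%:C * (2 * y%:C) by rewrite !rmorphM rmorph_nat.
  by rewrite E !nE !normrM normr_nat mulrC.
by rewrite ltr_norml complexReD complexReN /= => /andP[]; lra.
Qed.

(** The difference quotient of a square root s is governed by
    (s y - s z) (s y + s z) = s y ^+ 2 - s z ^+ 2, and s y + s z stays away from
    0 because the real part of s y is nonnegative. Continuity of s is not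
    presupposed. *)
Lemma sqrt_branch_derivable alpha z : alpha != 0 -> 0 < complex.Re (1 - 2 * alpha * z) ->
  derivable (sqrt_branch alpha : R[i]^o -> R[i]^o) z 1.
Proof.
move=> a0 z0; pose s y := sqrtc (1 - 2 * alpha * y).
have sE y : s y ^+ 2 = 1 - 2 * alpha * y by exact: sqr_sqrtc.
have sz : 0 < complex.Re (s z).
  by rewrite lt_neqAle Re_sqrtc_ge0 eq_sym andbT Re_neq0_of_sqr// sE.
pose rho := (complex.Re (s z))%:C.
have rho0 : 0 < rho by rewrite ltcR.
have sum_ge y : rho <= `|s y + s z|.
  apply: le_trans (normc_ge_Re _); rewrite lecR complexReD.
  by apply: le_trans (ler_norm _); rewrite lerDr Re_sqrtc_ge0.
have sum_neq0 y : s y + s z != 0 by rewrite -normr_gt0 (lt_le_trans rho0).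
have sz_ge : rho <= `|s z|.
  by apply: le_trans (normc_ge_Re _); rewrite lecR ler_norm.
have sz_neq0 : s z != 0 by rewrite -normr_gt0 (lt_le_trans rho0).
have diff y : s y - s z = - (2 * alpha * (y - z)) / (s y + s z).
  by apply: (mulIf (sum_neq0 y)); rewrite divfK// -subr_sqr !sE; ring.
suff /is_derive_limit H : forall e : R[i], 0 < e -> exists2 r : R[i], 0 < r &
    forall t : R[i], `|t| < r ->
      `|sqrt_branch alpha (z + t) - sqrt_branch alpha z - (s z)^-1 * t| <= e * `|t|.
  by case: H.
have K0 : 0 < rho ^+ 3 / (2 * `|alpha|) by rewrite divr_gt0 ?exprn_gt0 ?mulr_gt0 ?normr_gt0.
move=> e e0; exists (e * (rho ^+ 3 / (2 * `|alpha|))); first by rewrite mulr_gt0.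
move=> t tr.
have -> : sqrt_branch alpha (z + t) - sqrt_branch alpha z - (s z)^-1 * t =
    2 * alpha * t / ((s (z + t) + s z) ^+ 2 * s z) * t.
  have D := diff (z + t); rewrite addrAC subrr add0r in D.
  have B : sqrt_branch alpha (z + t) - sqrt_branch alpha z = 2 * t / (s (z + t) + s z).
    rewrite /sqrt_branch -/(s (z + t)) -/(s z) -mulrBl (_ : _ - _ = - (s (z + t) - s z)); last by ring.
    by rewrite D; field; rewrite sum_neq0 a0.
  rewrite B; apply/eqP; rewrite -subr_eq0; apply/eqP.
  transitivity (t / (s (z + t) + s z) ^+ 2 / s z *
     (2 * (s (z + t) + s z) * s z - (s (z + t) + s z) ^+ 2 - 2 * alpha * t)).
    by field; rewrite sum_neq0 sz_neq0.
  rewrite (_ : 2 * (s (z + t) + s z) * s z - (s (z + t) + s z) ^+ 2 - 2 * alpha * t =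
    s z ^+ 2 - s (z + t) ^+ 2 - 2 * alpha * t); last by ring.
  by rewrite !sE; ring.
rewrite normrM ler_wpM2r// normf_div ler_pdivrMr; last first.
  by rewrite normr_gt0 mulf_neq0// expf_neq0.
apply: le_trans (_ : e * rho ^+ 3 <= _).
  move: tr; rewrite mulrA ltr_pdivlMr ?mulr_gt0 ?normr_gt0// => tr.
  by rewrite !normrM normr_nat mulrC ltW.
rewrite ler_pM2l// normrM normrX exprSr ler_pM ?exprn_ge0 ?(ltW rho0)//.
by rewrite lerXn2r// nnegrE ?normr_ge0// ltW.
Qed.

(** (1 - alpha phi)^2 = 1 - 2 alpha z has positive real part on the disc, so the
    real part of 1 - alpha phi does not vanish there; it is 1 at 0, hence positive
    on the component of 0, and this singles out the principal root. *)
Lemma sqrt_branch_extension (U : set R[i]^o) (phi : R[i] -> R[i]) alpha :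
  open U -> U 0 -> (forall z, U z -> cts phi z) -> phi 0 = 0 -> alpha != 0 ->
  (forall z, U z -> phi z - 2^-1 * alpha * (phi z * phi z) = z) ->
  let r := 1 / (2 * complex.Re `|alpha|) in
  holomorphic_extension (connected_component (U `&` disc r) 0) (disc r)
    phi (sqrt_branch alpha).
Proof.
move=> openU U0 phic phi0 a0 phiE r.
pose K := connected_component (U `&` disc r) (0 : R[i]^o).
have KU z : K z -> U z /\ disc r z by move=> /connected_component_sub.
pose g z := 1 - alpha * phi z.
have gE z : U z -> 1 - 2 * alpha * z = g z ^+ 2.
  by move=> Uz; rewrite -{1}(phiE z Uz) /g; field.
have gc z : U z -> cts g z.
  by move=> Uz; exact: ctsB (cts_cst 1 z) (ctsZ (phic z Uz)).
have g_neq0 z : U z -> disc r z -> complex.Re (g z) != 0.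
  by move=> Uz /(Re_disc_gt0 a0); rewrite gE//; exact: Re_neq0_of_sqr.
have K0 : K 0.
  apply: connected_component_refl; split=> //.
  have n0 : 0 < complex.Re `|alpha| by move: a0; rewrite -normr_gt0 ltcE => /andP[].
  suff : complex.Re `|0 : R[i]| < r by [].
  by rewrite normr0 divr_gt0 ?mulr_gt0.
pose P := [set z : R[i]^o | U z /\ 0 < complex.Re (g z)].
pose N := [set z : R[i]^o | U z /\ complex.Re (g z) < 0].
have nU z : U z -> \forall y \near (z : R[i]^o), U y by move=> Uz; apply: open_nbhs_nbhs.
have opP : open P.
  rewrite openE => z [Uz gz]; rewrite /interior /=.
  have /cts_square/(_ _ gz)[d d0 Hd] := gc z Uz.
  have : \forall y \near (z : R[i]^o), 0 < complex.Re (g y).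
    apply/nbhs_square; exists d => // y yr yi; have [+ _] := Hd y yr yi.
    by rewrite ltr_norml => /andP[]; lra.
  by apply: filterS2 (nU z Uz) => y.
have opN : open N.
  rewrite openE => z [Uz gz]; rewrite /interior /=.
  have gz' : 0 < - complex.Re (g z) by rewrite oppr_gt0.
  have /cts_square/(_ _ gz')[d d0 Hd] := gc z Uz.
  have : \forall y \near (z : R[i]^o), complex.Re (g y) < 0.
    apply/nbhs_square; exists d => // y yr yi; have [+ _] := Hd y yr yi.
    by rewrite ltr_norml => /andP[]; lra.
  by apply: filterS2 (nU z Uz) => y.
have KP : K `&` P = K.
  apply: (@component_connected _ (U `&` disc r) (0 : R[i]^o)).
  - by exists 0; split=> //; split=> //; rewrite /g phi0 mulr0 subr0.
  - by exists P.
  - exists (~` N); first by rewrite closedC.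
    apply/seteqP; split=> z [Kz].
    + by move=> [Uz gz]; split=> // -[_]; rewrite ltNge (ltW gz).
    + move=> nN; have [Uz dz] := KU z Kz; split=> //; split=> //.
      by rewrite lt_neqAle eq_sym g_neq0//= leNgt; apply/negP => gz; apply: nN.
split.
- by move=> z /KU[].
- by move=> z dz; apply: sqrt_branch_derivable => //; exact: Re_disc_gt0.
- move=> z Kz; have [_ [Uz gz]] : (K `&` P) z by rewrite KP.
  rewrite /sqrt_branch (sqrtc_unique gz (gE z Uz)) /g; field; exact: a0.
Qed.

End SquareRoot.

(** * The Monge-Ampere equation in terms of phi *)
Section Coefficients.
Variable R : realType.

Lemma csmooth_wirtinger (V : set R[i]^o) (b : R[i] -> R[i]) : open V -> csmooth_on1 V b ->
  exists p q m m' : R[i] -> R[i], forall w, V w -> [/\ is_wirtinger b w (p w) (q w),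
    exists t, is_wirtinger q w (m w) t & exists t, is_wirtinger (fun w => conjc (p w)) w (m' w) t].
Proof.
move=> oV [/(smooth1_C2 oV)[Q1 [S1 [T1 H1]]] /(smooth1_C2 oV)[Q2 [S2 [T2 H2]]]].
exists (fun w => conjc (Q1 w) + 'i * conjc (Q2 w)), (fun w => Q1 w + 'i * Q2 w).
exists (fun w => S1 w + 'i * S2 w), (fun w => S1 w - 'i * S2 w) => w Vw.
have [[b1 D1 _ _ _] _] := H1 w Vw; have [[b2 D2 _ _ _] _] := H2 w Vw; split.
- have := wdD b1 (wdZ 'i b2); apply: wd_near.
  by apply/nbhs_square; exists 1 => // y _ _; rewrite -complexE.
- by exists (T1 w + 'i * T2 w); exact: wdD D1 (wdZ 'i D2).
- exists (T1 w - 'i * T2 w).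
  have := wdB D1 (wdZ 'i D2); apply: wd_near.
  apply/nbhs_square; exists 1 => // y _ _.
  by rewrite conjcD conjcM conjc_i !conjcK mulNr.
Qed.

(** The determinant is |phi'|^2 times a quadratic polynomial in phi and conj phi,
    whose constant term is 1 because of the values at z = 0. The five
    coefficients are those of a * d^2 u/dw d(conj w) minus the squared modulus
    of d^2 u/dz d(conj w) divided by phi'. *)
Lemma monge_ampere_slice (U V : set R[i]^o) (phi : R[i] -> R[i])
    (a d : R[i] -> R) (b c : R[i] -> R[i]) (u : R[i] -> R[i] -> R) w Q S T :
  open U -> open V -> U 0 -> V w -> holomorphic_on U phi -> phi 0 = 0 -> cderiv phi 0 = 1 ->
  smooth_on1 V a -> csmooth_on1 V b -> csmooth_on1 V c -> smooth_on1 V d ->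
  0 < a w -> (forall z, U z -> cderiv phi z != 0) ->
  (forall z w, U z -> V w ->
       (u z w)%:C = (a w)%:C * `|phi z| ^+ 2
                    + b w * phi z ^+ 2 + conjc (b w * phi z ^+ 2)
                    + c w * phi z + conjc (c w * phi z) + (d w)%:C) ->
  C2_on U (fun z => u z w) Q S T ->
  (forall z w, U z -> V w -> \det (complex_hessian2 u z w) = 1) ->
  exists A B B' C C', forall z, U z -> cderiv phi z * conjc (cderiv phi z) *
    (A * (phi z * conjc (phi z)) + B * (phi z * phi z) + B' * conjc (phi z * phi z)
     + C * phi z + C' * conjc (phi z) + 1) = 1.
Proof.
move=> oU oV U0 Vw phi_holo phi0 phi'0 sa sb sc sd aw phi'_neq0 uE uC2 uMA.
have [Qa [Sa [Ta Ha]]] := smooth1_C2 oV sa.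
have [Qd [Sd [Td Hd]]] := smooth1_C2 oV sd.
have [pb [qb [mb [mb' Hb]]]] := csmooth_wirtinger oV sb.
have [pc [qc [mc [mc' Hc]]]] := csmooth_wirtinger oV sc.
pose B0 z x := conjc (cderiv phi z) *
  ((a x)%:C * phi z + 2 * conjc (b x * phi z) + conjc (c x)).
pose B1 z x := Qa x * (phi z * conjc (phi z)) + qb x * (phi z * phi z)
  + conjc (pb x) * conjc (phi z * phi z) + qc x * phi z + conjc (pc x) * conjc (phi z) + Qd x.
have uE' z x : U z -> V x -> (a x)%:C * (phi z * conjc (phi z)) + b x * (phi z * phi z)
    + conjc (b x * (phi z * phi z)) + c x * phi z + conjc (c x * phi z) + (d x)%:C = (u z x)%:C.
  by move=> Uz Vx; rewrite uE// sqr_normc !expr2.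
have P z (Uz : U z) := wd_phi phi_holo Uz.
have H0 y x : U y -> V x -> exists p, is_wirtinger (fun y => (u y x)%:C) y p (B0 y x).
  move=> Uy Vx; eexists.
  have := wd_quadratic (b x) (c x) (conjc_real (a x)) (conjc_real (d x)) (P y Uy).
  by apply: wd_near; apply: filterS (near_open oU Uy) => t Ut; exact: uE'.
have H1 y x : U y -> V x -> exists p, is_wirtinger (fun x => (u y x)%:C) x p (B1 y x).
  move=> Uy Vx; eexists.
  have [[ax _ _ _ _] _] := Ha x Vx; have [[dx _ _ _ _] _] := Hd x Vx.
  have [bx _ _] := Hb x Vx; have [cx _ _] := Hc x Vx.
  have k (F : R[i] -> R[i]) p q e (HF : is_wirtinger F x p q) := wdM HF (wd_cst e x).
  have := wdD (wdD (wdD (wdD (wdD (k _ _ _ (phi y * conjc (phi y)) ax)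
    (k _ _ _ (phi y * phi y) bx)) (wd_conj (k _ _ _ (phi y * phi y) bx)))
    (k _ _ _ (phi y) cx)) (wd_conj (k _ _ _ (phi y) cx))) dx.
  move/wd_eq => /(_ _ (B1 y x) erefl) H.
  apply: wd_near (H _); first by apply: filterS (near_open oV Vx) => t Vt; exact: uE'.
  by rewrite /B1 !(conjcD, conjcM, conjc0, mulr0, addr0).
have [[aw1 aw2 _ _ _] _] := Ha w Vw; have [[_ dw2 _ _ _] _] := Hd w Vw.
have [bw1 [tb bw2] [tb' bw3]] := Hb w Vw; have [cw1 [tc cw2] [tc' cw3]] := Hc w Vw.
pose k z := Qa w * conjc (phi z) + 2 * qb w * phi z + qc w.
pose k' z := conjc (Qa w) * phi z + 2 * conjc (qb w) * conjc (phi z) + conjc (qc w).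
pose n z := Sa w * (phi z * conjc (phi z)) + mb w * (phi z * phi z)
  + mb' w * conjc (phi z * phi z) + mc w * phi z + mc' w * conjc (phi z) + Sd w.
have MA z : U z -> cderiv phi z * conjc (cderiv phi z) * ((a w)%:C * n z - k z * k' z) = 1.
  move=> Uz; rewrite -[RHS](uMA z w Uz Vw).
  have [[_ Qz _ _ _] _] := uC2 z Uz.
  have E00 : is_wirtinger (fun y => B0 y w) z (S z) (T z).
    apply: wd_near Qz; apply: filterS (near_open oU Uz) => y Uy.
    by rewrite (dbar_u0 oU phi_holo (fun z Uz => uE z w Uz Vw) uC2 Uy).
  have PP := wdM (P z Uz) (P z Uz).
  have E01 : exists q, is_wirtinger (fun y => B1 y w) z (cderiv phi z * k z) q.
    eexists; have := wdD (wdD (wdD (wdD (wdD (wdZ (Qa w) (wdM (P z Uz) (wd_conj (P z Uz))))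
      (wdZ (qb w) PP)) (wdZ (conjc (pb w)) (wd_conj PP))) (wdZ (qc w) (P z Uz)))
      (wdZ (conjc (pc w)) (wd_conj (P z Uz)))) (wd_cst (Qd w) z).
    move/wd_eq => /(_ (cderiv phi z * k z)); apply; last by reflexivity.
    by rewrite /k !(conjcD, conjcM, conjc0); ring.
  have E10 : exists q, is_wirtinger (fun x => B0 z x) w (conjc (cderiv phi z) * k' z) q.
    eexists; have := wdZ (conjc (cderiv phi z)) (wdD (wdD (wdM aw1 (wd_cst (phi z) w))
      (wdZ 2 (wd_conj (wdM bw1 (wd_cst (phi z) w))))) (wd_conj cw1)).
    move/wd_eq => /(_ (conjc (cderiv phi z) * k' z)); apply; last by reflexivity.
    by rewrite /k' !(conjcD, conjcM, conjc0); ring.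
  have E11 : exists q, is_wirtinger (fun x => B1 z x) w (n z) q.
    eexists; have := wdD (wdD (wdD (wdD (wdD (wdM aw2 (wd_cst (phi z * conjc (phi z)) w))
      (wdM bw2 (wd_cst (phi z * phi z) w))) (wdM bw3 (wd_cst (conjc (phi z * phi z)) w)))
      (wdM cw2 (wd_cst (phi z) w))) (wdM cw3 (wd_cst (conjc (phi z)) w))) dw2.
    move/wd_eq => /(_ (n z)); apply; last by reflexivity.
    by rewrite /n !mulr0 !addr0.
  have [q01 {}E01] := E01; have [q10 {}E10] := E10; have [q11 {}E11] := E11.
  rewrite (det_complex_hessian2 oU oV Uz Vw H0 H1 E00 E01 E10 E11).
  rewrite (laplacian_u0 oU phi_holo (fun z Uz => uE z w Uz Vw) uC2 Uz).
  ring.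
have D1 : (a w)%:C * Sd w - qc w * conjc (qc w) = 1.
  rewrite -[RHS](MA 0 U0) phi'0 conjc1 /n /k /k' phi0 conjc0; ring.
exists ((a w)%:C * Sa w - (Qa w * conjc (Qa w) + 4 * (qb w * conjc (qb w)))),
  ((a w)%:C * mb w - 2 * (qb w * conjc (Qa w))),
  ((a w)%:C * mb' w - 2 * (Qa w * conjc (qb w))),
  ((a w)%:C * mc w - (2 * (qb w * conjc (qc w)) + qc w * conjc (Qa w))),
  ((a w)%:C * mc' w - (Qa w * conjc (qc w) + 2 * (qc w * conjc (qb w)))) => z Uz.
rewrite -[RHS](MA z Uz); congr (_ * _); rewrite -[X in _ + X = _]D1 /n /k /k' !conjcM; ring.
Qed.

End Coefficients.

Theorem theorem6p1 (R : realType) (U V : set R[i]^o) (phi : R[i] -> R[i])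
    (a d : R[i] -> R) (b c : R[i] -> R[i]) (u : R[i] -> R[i] -> R)
    (U_domain : domain U) (U0 : U 0) (V_domain : domain V)
    (phi_holo : holomorphic_on U phi) (phi0 : phi 0 = 0)
    (dphi_neq0 : forall z : R[i], U z -> cderiv phi z != 0)
    (dphi0 : cderiv phi 0 = 1)
    (a_smooth : smooth_on1 V a) (b_smooth : csmooth_on1 V b)
    (c_smooth : csmooth_on1 V c) (d_smooth : smooth_on1 V d)
    (a_gt0 : forall w : R[i], V w -> 0 < a w)
    (uE : forall z w : R[i], U z -> V w ->
       (u z w)%:C = (a w)%:C * `|phi z| ^+ 2
                    + b w * phi z ^+ 2 + conjc (b w * phi z ^+ 2)
                    + c w * phi z + conjc (c w * phi z) + (d w)%:C)
    (u_smooth : smooth_on2 U V u)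
    (u_MA : forall z w : R[i], U z -> V w -> \det (complex_hessian2 u z w) = 1) :
  holomorphic_extension U setT phi (fun z => z)
  \/ exists alpha : R[i], alpha != 0 /\
       holomorphic_extension
         (connected_component (U `&` disc (1 / (2 * complex.Re `|alpha|))) 0)
         (disc (1 / (2 * complex.Re `|alpha|)))
         phi (sqrt_branch alpha).
Proof.
have [_ oU conU] := U_domain; have [[w Vw] oV _] := V_domain.
have [Q [S [T uC2]]] := smooth2_C2 oU Vw u_smooth.
have aw := a_gt0 w Vw; have uwE z (Uz : U z) := uE z w Uz Vw.
have [A [B [B' [C [C' modulusE]]]]] := monge_ampere_slice oU oV U0 Vw phi_holo phi0 dphi0
  a_smooth b_smooth c_smooth d_smooth aw dphi_neq0 uE uC2 u_MA.
pose W := regular_set U phi (a w) (b w) (c w).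
have DW y : W y -> is_wirtinger (fun y => cderiv phi y * (1 + C * phi y)) y 0 0.
  move=> Wy; have [p pP _] := phi'_holo oU phi_holo uwE uC2 Wy.
  apply: (@primitive_derivative_locally_constant R W phi (cderiv phi) p A B B' C C' _ _ _ _ y Wy).
  - by move=> z; exact: (near_regular oU phi_holo).
  - move=> z Wz; have [D pc] := pP z Wz; have [Uz _] := Wz.
    have phi'c := cts_phi' oU phi_holo uwE uC2 Wz.
    by have phic := cts_phi phi_holo Uz; have phiD := wd_phi phi_holo Uz.
  - by move=> z [Uz _]; exact: dphi_neq0.
  - by move=> z [Uz _]; exact: modulusE.
have phiE := quadratic_identity oU phi_holo aw dphi_neq0 uwE uC2 DW conU U0 phi0 dphi0.
have [C0|C0] := eqVneq C 0; [left|right].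
- split=> // z Uz.
  by rewrite -[RHS](phiE z Uz) C0 mulr0 mul0r addr0.
- exists (- C); split; first by rewrite oppr_eq0.
  apply: (sqrt_branch_extension oU U0 (fun z Uz => cts_phi phi_holo Uz) phi0).
  + by rewrite oppr_eq0.
  + by move=> z Uz; rewrite mulrN mulNr opprK phiE.
Qed.
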